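(* Let $\Omega\subset\mathbb{R}^d$ ($d\in\{1,2,3\}$) be a bounded domain, let $0<\alpha<1$, $T>0$, and let $M_1,M_2,f_1,f_2:\mathbb{R}^2\to\mathbb{R}$ satisfy: (H1) there are constants $0<m_1\le m_2$ with $m_1\le M_i(x,y)\le m_2$ for all $x,y\in\mathbb{R}$, $i=1,2$; (H2) each $M_i$ is Lipschitz: $|M_i(x_1,y_1)-M_i(x_2,y_2)|\le L_i'|x_1-x_2|+K_i'|y_1-y_2|$; (H3) each $f_i$ is Lipschitz: $|f_i(x_1,y_1)-f_i(x_2,y_2)|\le L_i|x_1-x_2|+K_i|y_1-y_2|$. Let $X_h$, $\tau=T/N$, $t_n=n\tau$, $D^\alpha_\tau$, $U^{n,\alpha}$, $V^{n,\alpha}$ and $l(\cdot)$ be as in the context, and let $U^n,V^n\in X_h$, $1\le n\le N$, be a solution of the fully discrete scheme: $U^0=V^0=0$ and for each $n=1,\dots,N$, $$(D^\alpha_\tau U^n,w)+M_1\big(l(U^{n,\alpha}),l(V^{n,\alpha})\big)(\nabla U^{n,\alpha},\nabla w)=(f_1(U^{n,\alpha},V^{n,\alpha}),w)\quad\forall w\in X_h,$$ $$(D^\alpha_\tau V^n,\omega)+M_2\big(l(U^{n,\alpha}),l(V^{n,\alpha})\big)(\nabla V^{n,\alpha},\nabla \omega)=(f_2(U^{n,\alpha},V^{n,\alpha}),\omega)\quad\forall \omega\in X_h.$$ Then there exists a constant $\tau^*>0$, independent of $h$, such that whenever $\tau\le\tau^*$, $$\|U^n\|+\|V^n\|\le C\quad\text{and}\quad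 \|\nabla U^n\|+\|\nabla V^n\|\le C,\qquad 1\le n\le N,$$ where $C>0$ is a constant independent of $h$ and $\tau$.
   Context: $(\cdot,\cdot)$ and $\|\cdot\|$ denote the inner product and norm of $L^2(\Omega)$. $\Omega_h$ is a quasi-uniform partition of $\Omega$ into intervals (for $d=1$) or triangles with mesh size $h$, and $X_h=\{w\in C^0(\bar\Omega): w|_{T_k}\in P_1(T_k)\ \forall T_k\in\Omega_h,\ w=0 \text{ on }\partial\Omega\}\subset H^1_0(\Omega)$ (continuous piecewise linear finite elements). Time step $\tau=T/N$, $t_n=n\tau$. For a sequence $\phi^0,\phi^1,\dots$, the fractional Crank–Nicolson approximation of the Caputo derivative is $D^\alpha_\tau\phi^n=\tau^{-\alpha}\sum_{j=0}^n b_{n-j}\phi^j$ with $b_k=(-1)^k\frac{\Gamma(\alpha+1)}{\Gamma(k+1)\Gamma(\alpha-k+1)}$. Also $U^{n,\alpha}=(1-\frac{\alpha}{2})U^n+\frac{\alpha}{2}U^{n-1}$, $V^{n,\alpha}=(1-\frac{\alpha}{2})V^n+\frac{\alpha}{2}V^{n-1}$, $l(w)=\int_\Omega w\,dx$, and $f_i(U,V)$ denotes the pointwise composition $x\mapsto f_i(U(x),V(x))$. *)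

(* Defs.v *)
From HB Require Import structures.
From mathcomp Require Import all_boot all_order all_algebra.
From mathcomp Require Import all_classical all_reals all_analysis.
Set Implicit Arguments.
Unset Strict Implicit.
Unset Printing Implicit Defensive.
Import Order.TTheory GRing.Theory Num.Theory.
Import numFieldNormedType.Exports.
Local Open Scope classical_set_scope.
Local Open Scope ring_scope.

Section FEM.
Context {R : realType}.

Notation pt d := 'rV[R]_d.

Definition enorm d (v : pt d) : R := Num.sqrt (\sum_(i < d) v 0 i ^+ 2).

(* Iterated Lebesgue integral over R^d (= the d-dimensional Lebesgue
   integral, by Fubini, for the integrable integrands used below). *)
Fixpoint iint (n : nat) : (pt n -> R) -> R :=
  match n return (pt n -> R) -> R with
  | 0 => fun g => g 0
  | n'.+1 => fun g =>
      Rintegral (@lebesgue_measure R) setT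
        (fun t : R => iint (fun y : pt n' => g (row_mx (const_mx t : 'rV[R]_1) y)))
  end.

Definition integ d (Om : set (pt d)) (g : pt d -> R) : R :=
  iint (fun x => if x \in Om then g x else 0).

Definition L2ip d (Om : set (pt d)) (u w : pt d -> R) : R :=
  integ Om (fun x => u x * w x).
Definition L2norm d (Om : set (pt d)) (u : pt d -> R) : R :=
  Num.sqrt (L2ip Om u u).

Definition lfun d (Om : set (pt d)) (w : pt d -> R) : R := integ Om w.

Definition evec d (i : 'I_d) : pt d := delta_mx 0 i.
Definition pderiv d (i : 'I_d) (u : pt d -> R) (x : pt d) : R :=
  'D_(evec i) u x.

(* (grad u, grad w) in L^2(Omega)^d; for continuous piecewise linear
   functions the classical gradient exists a.e. and is the weak gradient. *)
Definition H1ip d (Om : set (pt d)) (u w : pt d -> R) : R :=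
  integ Om (fun x => \sum_(i < d) pderiv i u x * pderiv i w x).
Definition H1semi d (Om : set (pt d)) (u : pt d -> R) : R :=
  Num.sqrt (H1ip Om u u).

Definition simplex d := {ffun 'I_d.+1 -> pt d}.

Definition subhull d (S : simplex d) (P : pred 'I_d.+1) : set (pt d) :=
  [set x | exists l : 'I_d.+1 -> R,
     [/\ forall i, 0 <= l i, forall i, ~~ P i -> l i = 0,
         \sum_i l i = 1 & x = \sum_i l i *: S i]].
Definition hull d (S : simplex d) : set (pt d) := subhull S predT.

Definition nondeg d (S : simplex d) : Prop :=
  \det (\matrix_(i < d, j < d) (S (lift ord0 i) - S ord0) 0 j) != 0.

Definition diam d (S : simplex d) : R :=
  \big[Num.max/0]_(i < d.+1) \big[Num.max/0]_(j < d.+1) enorm (S i - S j).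

Definition mesh d := seq (simplex d).

Definition meshsize d (Th : mesh d) : R := \big[Num.max/0]_(S <- Th) diam S.

Definition partition d (Om : set (pt d)) (Th : mesh d) : Prop :=
  [/\ uniq Th,
      forall S, S \in Th -> nondeg S,
      closure Om = [set x | exists2 S, S \in Th & hull S x] &
      forall S S', S \in Th -> S' \in Th -> S != S' ->
        hull S `&` hull S' = subhull S (fun i => [exists j, S' j == S i])].

Definition eball d (c : pt d) (r : R) : set (pt d) :=
  [set x | enorm (x - c) < r].

Definition quasi_uniform_family d (Om : set (pt d)) (F : set (mesh d)) : Prop :=
  (forall Th, F Th -> partition Om Th) /\
  exists2 kappa : R, 0 < kappa &
    forall Th, F Th -> forall S, S \in Th ->
      exists c, eball c (kappa * meshsize Th) `<=` hull S.

Definition Xh d (Om : set (pt d)) (Th : mesh d) : set (pt d -> R) :=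
  [set w | [/\ {within closure Om, continuous w},
     forall S, S \in Th -> exists (a : R) (g : pt d),
        forall x, hull S x -> w x = a + \sum_(i < d) g 0 i * x 0 i &
     forall x, (closure Om `\` Om) x -> w x = 0]].

(* generalized binomial coefficient binom(alpha, k) = prod_{i<k} (alpha-i)/(i+1);
   b_k = (-1)^k Gamma(alpha+1)/(Gamma(k+1) Gamma(alpha-k+1)) = (-1)^k binom(alpha,k) *)
Definition gbinom (alpha : R) (k : nat) : R :=
  \prod_(i < k) ((alpha - i%:R) / (i%:R + 1)).
Definition bcoef (alpha : R) (k : nat) : R := (-1) ^+ k * gbinom alpha k.

Definition Dfrac d (alpha tau : R) (phi : nat -> pt d -> R) (n : nat) : pt d -> R :=
  fun x => tau `^ (- alpha) * \sum_(j < n.+1) bcoef alpha (n - j) * phi j x.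

Definition shiftal d (alpha : R) (phi : nat -> pt d -> R) (n : nat) : pt d -> R :=
  fun x => (1 - alpha / 2) * phi n x + (alpha / 2) * phi n.-1 x.

End FEM.

(* Main.v *)
Require Import Defs.
From HB Require Import structures.
From mathcomp Require Import all_boot all_order all_algebra ring lra.
From mathcomp Require Import all_classical all_reals all_analysis.
From mathcomp Require Import measurable_realfun.
Import Order.TTheory GRing.Theory Num.Theory.
Import numFieldNormedType.Exports.
Local Open Scope classical_set_scope.
Local Open Scope ring_scope.

(* The convolution weights b_k satisfy b_0 = 1, b_k <= 0 for k >= 1 and have
   nonnegative partial sums, which yields for real sequences the inequality
   2 phi^{n,alpha} D phi^n >= D (phi^2)^n.  Integrated over Omega it gives
   the L^2 estimate from w = U^{n,alpha} and the gradient estimate from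
   w = D U^n, the latter after division by the nonlocal coefficient M_i, which
   is a number bounded below by m_1.  Both energies then obey
   D y^n <= C0 + C1 (y^n + y^(n-1)), and y is compared with the geometric
   sequence z_n = (1 - lam tau)^(-n): since the partial sums of
   sum_k b_k x^k dominate (1 - x)^alpha, one has D z^n >= lam^alpha z_n.
   For the integrals, the gradient of a finite element function is locally
   constant off the finitely many hyperplanes carrying the faces of the mesh. *)

(** * Convolution weights and discrete fractional Gronwall inequality *)

(** The memory inequality concerns real sequences and is applied at each point x, so the mesh never
    enters the constants: they depend only on alpha, T, the volume of Omega, m_1 and the linear
    growth of f_1, f_2. The gradient estimate comes second because its right-hand side contains the
    L^2 energies: testing with D U^n, Young's inequality with constants 1 and 1/4 cancels the whole
    square of D U^n and leaves only (f, f). Once the L^2 energy is bounded, the gradient recursion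
    has C1 = 0. A geometric comparison sequence is natural because its convolution with b factors
    into a partial generating sum times the newest term. The step restriction is lam tau <= 1/2,
    where lam^alpha > 2 C1 + C0. The integration theory is needed because [iint] and [pderiv] are
    total functions whose linearity has to be earned. The class [adm] contains finite element
    functions cut off to Omega, their partial derivatives and f(U,V), and is stable under linear
    combinations and products. *)

Section Coefficients.
Context {R : realType} (alpha : R).
Local Notation b := (bcoef alpha).

Lemma bcoef0 : b 0 = 1.
Proof. by rewrite /bcoef /gbinom big_ord0 expr0 mulr1. Qed.

Lemma bcoefS k : k.+1%:R * b k.+1 = (k%:R - alpha) * b k.
Proof.
rewrite /bcoef /gbinom big_ord_recr /= exprS.
have : k%:R + 1 != 0 :> R by rewrite natr1 pnatr_eq0.
rewrite -natr1 => k0.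
by field.
Qed.

Lemma bcoef1 : b 1 = - alpha.
Proof. by have := bcoefS 0; rewrite bcoef0 mul1r mulr1 sub0r. Qed.

(** A telescoping sum: [bcoefS] reads alpha b_k = k b_k - (k+1) b_{k+1}. The sign of a partial sum
    is thus read off from the next weight. *)
Lemma sum_bcoef n : alpha * \sum_(k < n.+1) b k = - (n.+1%:R * b n.+1).
Proof.
elim: n => [|n IH]; first by rewrite big_ord1 bcoef0 bcoef1 mul1r mulr1 opprK.
rewrite big_ord_recr /= mulrDr IH (bcoefS n.+1); ring.
Qed.

Hypotheses (alpha0 : 0 < alpha) (alpha1 : alpha < 1).

Lemma bcoefS_le0 k : b k.+1 <= 0.
Proof.
elim: k => [|k IH]; first by rewrite bcoef1 oppr_le0 ltW.
have k2 : 0 < k.+2%:R :> R by rewrite ltr0n.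
rewrite -(pmulr_rle0 _ k2) bcoefS mulr_ge0_le0// subr_ge0.
rewrite -natr1; have := ler0n R k; move: alpha0 alpha1; lra.
Qed.

Lemma sum_bcoef_ge0 n : 0 <= \sum_(k < n.+1) b k.
Proof.
by rewrite -(pmulr_rge0 _ alpha0) sum_bcoef oppr_ge0 mulr_ge0_le0// bcoefS_le0.
Qed.

Lemma sum_bcoef_rev n (f : nat -> R) :
  \sum_(j < n.+1) b (n - j) * f j = \sum_(k < n.+1) b k * f (n - k)%N.
Proof.
rewrite (reindex_inj rev_ord_inj)/=; apply: eq_bigr => i _.
by rewrite subSS subKn// -ltnS.
Qed.

(* With [S = p1 - alpha p0 - Q] the convolution sum, [X = (1 - alpha) S] and
   [Z = (1 - alpha) p0 - Q], the difference of the two sides times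
   [2 (1 - alpha)] is [((1 - alpha) W - Q^2) + X^2 + alpha X Z + alpha Z^2]. *)
Lemma bcoef_conv_quad (p0 p1 Q W : R) : Q ^+ 2 <= (1 - alpha) * W ->
  (p1 ^+ 2 - alpha * p0 ^+ 2 - W) / 2 <=
  ((1 - alpha / 2) * p1 + alpha / 2 * p0) * (p1 - alpha * p0 - Q).
Proof.
have a0 := alpha0; have a1 := alpha1.
move=> QW; rewrite -subr_ge0.
set S := p1 - alpha * p0 - Q; set r := 1 - alpha.
have r0 : 0 < 2 * r by rewrite /r; lra.
rewrite -(pmulr_rge0 _ r0).
have -> : 2 * r * (((1 - alpha / 2) * p1 + alpha / 2 * p0) * S
   - (p1 ^+ 2 - alpha * p0 ^+ 2 - W) / 2)
  = (r * W - Q ^+ 2) + ((r * S + alpha / 2 * (r * p0 - Q)) ^+ 2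
     + alpha * (1 - alpha / 4) * (r * p0 - Q) ^+ 2).
  by rewrite /S /r; field.
apply: addr_ge0; first by rewrite subr_ge0.
apply: addr_ge0; first exact: sqr_ge0.
by apply: mulr_ge0; [apply: mulr_ge0; lra|exact: sqr_ge0].
Qed.

(** With b_0 = 1 and b_1 = -alpha split off, the remaining weights with their sign changed are
    nonnegative of total mass at most 1 - alpha, because the full partial sum is nonnegative.
    Cauchy-Schwarz for this mass is then the hypothesis of [bcoef_conv_quad]. *)
Lemma bcoef_conv_ge (p : nat -> R) n :
  (\sum_(j < n.+2) b (n.+1 - j) * p j ^+ 2) / 2 <=
  ((1 - alpha / 2) * p n.+1 + alpha / 2 * p n)
    * \sum_(j < n.+2) b (n.+1 - j) * p j.
Proof.
have a0 := alpha0; have a1 := alpha1.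
have split2 (f : nat -> R) : \sum_(j < n.+2) b (n.+1 - j) * f j
    = f n.+1 - alpha * f n - \sum_(j < n) - b (n.+1 - j) * f j.
  rewrite big_ord_recr big_ord_recr /= subnn subSnn bcoef0 bcoef1.
  have -> : \sum_(j < n) - b (n.+1 - j) * f j
      = - \sum_(j < n) b (n.+1 - j) * f j.
    by rewrite -sumrN; apply: eq_bigr => i _; rewrite mulNr.
  by ring.
rewrite (split2 (fun j => p j ^+ 2)) (split2 p).
apply: bcoef_conv_quad.
set A := fun j : 'I_n => - b (n.+1 - j).
have A0 j : 0 <= A j.
  by rewrite /A oppr_ge0 subSn ?bcoefS_le0// ltnW.
have A1 : \sum_j A j <= 1 - alpha.
  have := sum_bcoef_ge0 n.+1.
  have := sum_bcoef_rev n.+1 (fun=> 1).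
  under [X in _ = X]eq_bigr do rewrite mulr1.
  move=> <-; rewrite (split2 (fun=> 1)) mulr1.
  under eq_bigr do rewrite mulr1.
  rewrite /A; lra.
rewrite -/A.
set Q := \sum_(j < n) A j * p j; set W := \sum_(j < n) A j * p j ^+ 2.
(* Cauchy-Schwarz as a variance: expanding the weighted sum of (p_j - c)^2 and bounding the mass by
   1 - alpha leaves W - c Q >= 0, which is the claim for this c. *)
pose c := Q / (1 - alpha).
have r0 : 0 < 1 - alpha by lra.
have : 0 <= \sum_(j < n) A j * (p j - c) ^+ 2.
  by apply: sumr_ge0 => j _; rewrite mulr_ge0// sqr_ge0.
have -> : \sum_(j < n) A j * (p j - c) ^+ 2
    = W - 2 * c * Q + c ^+ 2 * \sum_j A j.
  rewrite /W /Q !mulr_sumr -sumrB -big_split/=.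
  by apply: eq_bigr => j _; ring.
have : c ^+ 2 * (\sum_j A j) <= c ^+ 2 * (1 - alpha).
  by rewrite ler_wpM2l// sqr_ge0.
have -> : c ^+ 2 * (1 - alpha) = c * Q by rewrite /c; field; lra.
have -> : Q ^+ 2 = (1 - alpha) * (c * Q) by rewrite /c; field; lra.
by move=> h1 h2; rewrite ler_pM2l//; lra.
Qed.

(** The Taylor polynomial of t^alpha at t = 1, since (1 - x)^alpha is the sum of b_k x^k. *)
Let q n : {poly R} := \sum_(k < n.+1) b k *: (1 - 'X) ^+ k.

(** The function t^alpha solves t y' = alpha y; for its truncation all terms cancel but one, whose
    sign on [0,1] is that of b_{n+1}. *)
Let q_ode n : 'X * (q n)^`() - alpha *: q n = (n.+1%:R * b n.+1) *: (1 - 'X) ^+ n.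
Proof.
elim: n => [|n IH].
  rewrite /q big_ord1 expr0 bcoef0 scale1r derivC mulr0 sub0r bcoef1.
  by rewrite mul1r scaleNr.
rewrite /q big_ord_recr /= -/(q n) derivD derivZ deriv_exp derivB derivX derivC /=.
have -> : b n.+2 = n.+2%:R^-1 * ((n.+1%:R - alpha) * b n.+1).
  by rewrite -bcoefS mulKf// pnatr_eq0.
rewrite mulVKf ?pnatr_eq0//.
have -> : 'X * ((q n)^`() + b n.+1 *: ((0 - 1) * (1 - 'X) ^+ n *+ n.+1))
   - alpha *: (q n + b n.+1 *: (1 - 'X) ^+ n.+1) =
   ('X * (q n)^`() - alpha *: q n)
   + b n.+1 *: ('X * ((0 - 1) * (1 - 'X) ^+ n *+ n.+1) - alpha *: (1 - 'X) ^+ n.+1).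
  by rewrite -!mul_polyC; ring.
rewrite IH; move: (b n.+1) => x.
rewrite -!mul_polyC !polyCM polyCB !polyC_natr exprS; ring.
Qed.

(** The quotient [H] of [q n] by t^alpha equals 1 at t = 1, and by [q_ode] its derivative on ]0,1[
    has the sign of b_{n+1} <= 0. Hence it is at least 1 to the left of 1. *)
Lemma bcoef_gen_ge n (t : R) : 0 < t -> t <= 1 ->
  t `^ alpha <= \sum_(k < n.+1) b k * (1 - t) ^+ k.
Proof.
have a0 := alpha0; have a1 := alpha1.
move=> t0 t1.
have qE s : (q n).[s] = \sum_(k < n.+1) b k * (1 - s) ^+ k.
  rewrite /q horner_sum; apply: eq_bigr => k _.
  by rewrite hornerZ horner_exp !hornerE.
rewrite -qE.
pose H (s : R) : R := (q n).[s] * s `^ (- alpha).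
have dH (s : R) : 0 < s -> is_derive s (1 : R) H
    ((q n).[s] *: (- alpha * s `^ (- alpha - 1))
     + s `^ (- alpha) *: ((q n)^`()).[s]).
  by move=> s0; have := is_derive1_powR (- alpha) s0; apply: is_deriveM.
have H1 : H 1 = 1.
  rewrite /H /= /= powR1 mulr1 qE big_ord_recl /= bcoef0 expr0 big1 ?addr0 ?mulr1//.
  by move=> i _; rewrite subrr expr0n /= mulr0.
have : H 1 <= H t.
  apply: (@ler0_derive1_le _ H 0 1 _ _ false false) => //.
  - move=> s; rewrite in_itv/= => /andP[s0 _].
    by have := dH s s0 => -[].
  - move=> s; rewrite in_itv/= => /andP[s0 s1].
    rewrite derive1E (@derive_val _ _ _ _ _ _ _ (dH s s0)) /=.
    have [bb bb0 ode] : exists2 bb, bb <= 0 &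
        s * (q n)^`().[s] - alpha * (q n).[s] = n.+1%:R * bb * (1 - s) ^+ n.
      exists (b n.+1); first exact: bcoefS_le0.
      have := congr1 (fun p : {poly R} => p.[s]) (q_ode n).
      by move: (b n.+1) => bb; rewrite !hornerE.
    have -> : s `^ (- alpha - 1) = s `^ (- alpha) / s.
      rewrite powRB; last by rewrite (gt_eqF s0) implybT.
      by rewrite powRr1// ltW.
    have -> : (q n).[s] *: (- alpha * (s `^ (- alpha) / s))
          + s `^ (- alpha) *: (q n)^`().[s]
        = s `^ (- alpha) / s * (s * (q n)^`().[s] - alpha * (q n).[s]).
      rewrite /GRing.scale /=; field; exact: lt0r_neq0.
    rewrite ode mulr_ge0_le0//; first by rewrite divr_ge0 ?powR_ge0 ?ltW.
    apply: mulr_le0_ge0; last by rewrite exprn_ge0// subr_ge0 ltW.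
    exact: mulr_ge0_le0.
  - apply: derivable_within_continuous => s; rewrite in_itv/= => /andP[s0 _].
    by have := dH s s0 => -[].
  - by rewrite in_itv/= ltr01 lexx.
  - by rewrite in_itv/= t0.
rewrite H1 /H powRN.
by rewrite ler_pdivlMr ?powR_gt0// mul1r.
Qed.

(** The sequence z_n = (1 - lam tau)^(-n) is a supersolution: it is nondecreasing and at least 1, so
    C0 + C1 (z_{n+1} + z_n) <= (C0 + 2 C1) z_{n+1} <= lam^alpha z_{n+1}. Strong induction compares y
    with it. *)
Lemma frac_gronwall (lam C0 C1 tau : R) (y : nat -> R) (N : nat) :
  0 < lam -> 0 <= C0 -> 0 <= C1 -> 2 * C1 + C0 < lam `^ alpha ->
  0 < tau -> lam * tau <= 2^-1 -> y 0 <= 1 ->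
  (forall n, (n < N)%N ->
    tau `^ (- alpha) * \sum_(j < n.+2) bcoef alpha (n.+1 - j) * y j
      <= C0 + C1 * (y n.+1 + y n)) ->
  forall n, (n <= N)%N -> y n <= (1 - lam * tau)^-1 ^+ n.
Proof.
move=> lam0 C00 C10 lamC tau0 lamtau y0 hy.
set x := 1 - lam * tau; set t := tau `^ (- alpha).
have lt0 : 0 < lam * tau by exact: mulr_gt0.
have x0 : 0 < x by rewrite /x; lra.
have x1 : x <= 1 by rewrite /x; lra.
have xV1 : 1 <= x^-1 by rewrite invf_ge1.
have t0 : 0 < t by exact: powR_gt0.
have tlam : t * (lam * tau) `^ alpha = lam `^ alpha.
  rewrite powRM ?ltW// /t powRN mulrCA mulVf ?mulr1//.
  by rewrite gt_eqF// powR_gt0.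
(* The scheme is implicit: y_{n+1} also stands on the right with factor [C1]. It is absorbed on the
   left because lam tau <= 1 gives lam^alpha <= tau^(-alpha). *)
have tC1 : C1 < t.
  rewrite (@lt_le_trans _ _ (lam `^ alpha))//; first by lra.
  rewrite -tlam ger_pMr//; apply: (@le_trans _ _ (1 `^ alpha)).
    by rewrite ge0_ler_powR// ?nnegrE ?ltW//; lra.
  by rewrite powR1.
have z0 n : 0 < x^-1 ^+ n by rewrite exprn_gt0// invr_gt0.
elim/ltn_ind => -[_ _|n IH nN]; first by rewrite expr0.
have yz j : (j < n.+1)%N -> y j <= x^-1 ^+ j.
  by move=> jn; apply: IH => //; exact: leq_trans (ltnW jn) nN.
have := hy n nN; rewrite -/t big_ord_recr /= subnn bcoef0 mul1r.
(* Factoring out z_{n+1} turns the convolution into the generating sum at x, and 1 - x = lam tau. *)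
have zge : lam `^ alpha * x^-1 ^+ n.+1
    <= t * \sum_(j < n.+2) bcoef alpha (n.+1 - j) * x^-1 ^+ j.
  rewrite -tlam -mulrA ler_pM2l// (sum_bcoef_rev _ (fun j => x^-1 ^+ j)).
  have -> : \sum_(k < n.+2) bcoef alpha k * x^-1 ^+ (n.+1 - k)
      = (\sum_(k < n.+2) bcoef alpha k * x ^+ k) * x^-1 ^+ n.+1.
    rewrite mulr_suml; apply: eq_bigr => -[k /=]; rewrite ltnS => kn _.
    rewrite -mulrA; congr (_ * _).
    by rewrite -{2}(subnKC kn) exprD mulrA -exprMn mulfV ?expr1n ?mul1r// gt_eqF.
  rewrite ler_pM2r//; apply: bcoef_gen_ge => //; lra.
move: zge; rewrite big_ord_recr /= subnn bcoef0 mul1r.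
set sy := \sum_(i < n.+1) _ * y _; set sz := \sum_(i < n.+1) _ * x^-1 ^+ _.
(* The weights of the past values are nonpositive, so the induction hypothesis y_j <= z_j
   reverses. *)
have szy : sz <= sy.
  apply: ler_sum => i _; rewrite subSn ?(ltnW (ltn_ord i))//; last first.
    by rewrite -ltnS.
  by rewrite ler_wnM2l ?bcoefS_le0// yz.
have zz : x^-1 ^+ n <= x^-1 ^+ n.+1 by rewrite exprS ler_peMl// ltW.
have zz1 : 1 <= x^-1 ^+ n.+1 by rewrite exprn_ege1.
have yn := yz n (ltnSn n).
move=> zge yle.
have h1 : (2 * C1 + C0) * x^-1 ^+ n.+1 <= lam `^ alpha * x^-1 ^+ n.+1.
  by rewrite ler_pM2r// ltW.
have h2 : C1 * x^-1 ^+ n <= C1 * x^-1 ^+ n.+1 by rewrite ler_wpM2l.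
have h3 : C0 <= C0 * x^-1 ^+ n.+1 by rewrite ler_peMr.
have h4 : t * sz <= t * sy by rewrite ler_pM2l.
have h5 : C1 * y n <= C1 * x^-1 ^+ n by rewrite ler_wpM2l.
rewrite -(@ler_pM2l _ (t - C1)) ?subr_gt0//.
by lra.
Qed.

Lemma frac_gronwall_bounded (lam C0 C1 T : R) (N : nat) (y : nat -> R) :
  0 < lam -> 0 <= C0 -> 0 <= C1 -> 2 * C1 + C0 < lam `^ alpha ->
  0 < T -> (0 < N)%N -> T / N%:R <= (2 * lam)^-1 -> y 0 <= 1 ->
  (forall n, (n < N)%N ->
    (T / N%:R) `^ (- alpha) * \sum_(j < n.+2) bcoef alpha (n.+1 - j) * y j
      <= C0 + C1 * (y n.+1 + y n)) ->
  forall n, (n <= N)%N -> y n <= expR (2 * lam * T).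
Proof.
move=> lam0 C00 C10 lamC T0 N0 tauS y0 hy n nN.
set tau := T / N%:R in tauS hy.
have NR : 0 < N%:R :> R by rewrite ltr0n.
have tau0 : 0 < tau by rewrite divr_gt0.
have lt12 : lam * tau <= 2^-1.
  have -> : 2^-1 = lam * (2 * lam)^-1 :> R by field; rewrite gt_eqF.
  by rewrite ler_pM2l.
have lt0 : 0 < lam * tau by exact: mulr_gt0.
apply: le_trans
  (frac_gronwall lam C0 C1 tau y N lam0 C00 C10 lamC tau0 lt12 y0 hy n nN) _.
(* For 0 <= s <= 1/2, (1 + 2s)(1 - s) - 1 = s (1 - 2s) >= 0. The n-th power is then at most exp(2
   lam tau N), and tau N = T. *)
have : (1 - lam * tau)^-1 <= expR (2 * (lam * tau)).
  apply: le_trans (expR_ge1Dx _).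
  rewrite -[leLHS]mul1r ler_pdivrMr; last by lra.
  rewrite -subr_ge0.
  have -> : (1 + 2 * (lam * tau)) * (1 - lam * tau) - 1
     = (lam * tau) * (1 - 2 * (lam * tau)) by ring.
  by rewrite mulr_ge0//; lra.
move=> h; have : (1 - lam * tau)^-1 ^+ n <= expR (2 * (lam * tau)) ^+ n.
  by rewrite lerXn2r// nnegrE ?expR_ge0// invr_ge0; lra.
move=> /le_trans; apply.
rewrite -expRM_natl ler_expR.
have -> : 2 * lam * T = 2 * lam * (tau * N%:R) by rewrite /tau divfK// gt_eqF.
have nNR : n%:R <= N%:R :> R by rewrite ler_nat.
have : 2 * (lam * tau) * n%:R <= 2 * (lam * tau) * N%:R.
  by apply: ler_wpM2l => //; lra.
lra.
Qed.

(** The order of the quantifiers is the point: the threshold and the bound are fixed before [N] and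
    [y], which makes them uniform in the time step and in the mesh. *)
Lemma frac_gronwall_uniform (C0 C1 T : R) : 0 <= C0 -> 0 <= C1 -> 0 < T ->
  exists2 taustar, 0 < taustar & exists2 E, 0 < E &
  forall (N : nat) (y : nat -> R), (0 < N)%N -> T / N%:R <= taustar -> y 0 <= 1 ->
  (forall n, (n < N)%N ->
    (T / N%:R) `^ (- alpha) * \sum_(j < n.+2) bcoef alpha (n.+1 - j) * y j
      <= C0 + C1 * (y n.+1 + y n)) ->
  forall n, (n <= N)%N -> y n <= E.
Proof.
(* The added 1 gives the strict inequality required of lam^alpha = S, and keeps S positive when both
   constants vanish. *)
move=> C00 C10 T0; pose S := 2 * C1 + C0 + 1.
have S0 : 0 < S by rewrite /S; lra.
pose lam := S `^ alpha^-1.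
have lam0 : 0 < lam by exact: powR_gt0.
have lamE : 2 * C1 + C0 < lam `^ alpha.
  rewrite /lam -powRrM mulVf ?gt_eqF// powRr1; first by rewrite /S; lra.
  exact: ltW.
exists (2 * lam)^-1; first by rewrite invr_gt0 mulr_gt0.
exists (expR (2 * lam * T)); first exact: expR_gt0.
move=> N y N0 tauS y0 hy n nN.
exact: (frac_gronwall_bounded lam C0 C1 T N y lam0 C00 C10 lamE T0 N0 tauS y0
  hy n nN).
Qed.

End Coefficients.

(** * Iterated integrals of bounded Borel functions *)

Section IteratedIntegral.
Context {R : realType}.

(* ['rV[R]_n] carries no sigma-algebra in the library: Borel measurability is
   tested along all measurable families of coordinates. *)
Definition bmeas n (g : 'rV[R]_n -> R) : Prop :=
  forall dY (Y : measurableType dY) (c : 'I_n -> Y -> R),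
    (forall i, measurable_fun setT (c i)) ->
    measurable_fun setT (fun y => g (\row_i c i y)).

(** Joint measurability with a parameter: in the induction on the dimension, the coordinate
    integrated last moves into the parameter space. *)
Definition param_bmeas n dX (X : measurableType dX) (G : X -> 'rV[R]_n -> R) :=
  forall dY (Y : measurableType dY) (a : Y -> X) (c : 'I_n -> Y -> R),
    measurable_fun setT a -> (forall i, measurable_fun setT (c i)) ->
    measurable_fun setT (fun y => G (a y) (\row_i c i y)).

Definition cons_rv n (t : R) (y : 'rV[R]_n) : 'rV[R]_n.+1 :=
  row_mx (const_mx t : 'rV[R]_1) y.

Lemma cons_rv0 n (t : R) (y : 'rV[R]_n) : cons_rv n t y 0 ord0 = t.
Proof.
rewrite (_ : ord0 = lshift n (ord0 : 'I_1)); last exact: val_inj.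
by rewrite [LHS]row_mxEl mxE.
Qed.

Lemma cons_rv_lift n (t : R) (y : 'rV[R]_n) i :
  cons_rv n t y 0 (lift ord0 i) = y 0 i.
Proof.
rewrite (_ : lift ord0 i = rshift 1 i); last exact: val_inj.
exact: row_mxEr.
Qed.

Lemma cons_rv_row n (Y : Type) (t : Y -> R) (c : 'I_n -> Y -> R) y :
  cons_rv n (t y) (\row_i c i y) =
  \row_i (match fintype.split (i : 'I_(1 + n)) with inl _ => t | inr j => c j end) y.
Proof.
by apply/rowP => i; rewrite /cons_rv !mxE; case: fintype.split => j; rewrite mxE.
Qed.

Lemma measurable_split n dY (Y : measurableType dY) (t : Y -> R)
    (c : 'I_n -> Y -> R) (i : 'I_(1 + n)) :
  measurable_fun setT t -> (forall i, measurable_fun setT (c i)) ->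
  measurable_fun setT (match fintype.split i with inl _ => t | inr j => c j end).
Proof. by move=> mt mc; case: fintype.split. Qed.

Lemma iintS n (g : 'rV[R]_n.+1 -> R) :
  iint g = \int[lebesgue_measure]_t iint (fun y => g (cons_rv n t y)).
Proof. by []. Qed.

(** Induction on n for all parameter spaces at once: the inner integral is measurable on X * R, and
    Tonelli's theorem is applied to its positive and negative parts separately, so no integrability
    is involved. *)
Lemma measurable_iint n dX (X : measurableType dX) (G : X -> 'rV[R]_n -> R) :
  param_bmeas n _ X G -> measurable_fun setT (fun x => iint (G x)).
Proof.
elim: n dX X G => [|n IH] dX X G mG.
  have : measurable_fun setT (fun x => G x (\row_i cst 0 x)) by exact: (mG _ X id).
  by congr (measurable_fun _ _); apply/funext => x /=; congr G; apply/rowP => -[].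
pose F (p : X * R) := iint (fun y => G p.1 (cons_rv n p.2 y)).
have mF : measurable_fun setT F.
  apply: IH => dY Y a c ma mc.
  under eq_fun do rewrite (cons_rv_row n Y (fun y => (a y).2) c).
  apply: (mG _ _ (fun y => (a y).1)).
    exact: measurableT_comp.
  by move=> i; apply: measurable_split => //; exact: measurableT_comp.
have mEF : measurable_fun [set: X * R] (fun p : X * R => (F p)%:E).
  exact/measurable_EFinP.
rewrite (_ : (fun x => _) = fun x =>
  fine (\int[lebesgue_measure]_t (F (x, t))%:E))//.
apply: (measurableT_comp (fine_measurable measurableT)).
under eq_fun do rewrite integralE.
apply: emeasurable_funB.
- have := measurable_fun_fubini_tonelli_F (m2 := lebesgue_measure) _
    (measurable_funepos mEF) (fun=> funepos_ge0 _ _).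
  by rewrite /fubini_F unlock.
- have := measurable_fun_fubini_tonelli_F (m2 := lebesgue_measure) _
    (measurable_funeneg mEF) (fun=> funeneg_ge0 _ _).
  by rewrite /fubini_F unlock.
Qed.

Lemma bmeas_section n (g : 'rV[R]_n.+1 -> R) t :
  bmeas n.+1 g -> bmeas n (fun y => g (cons_rv n t y)).
Proof.
move=> mg dY Y c mc.
under eq_fun do rewrite (cons_rv_row n Y (cst t) c).
by apply: mg => i; apply: measurable_split.
Qed.

Lemma measurable_iint_section n (g : 'rV[R]_n.+1 -> R) : bmeas n.+1 g ->
  measurable_fun setT (fun t : R => iint (fun y => g (cons_rv n t y))).
Proof.
move=> mg; apply: measurable_iint => dY Y a c ma mc.
under eq_fun do rewrite (cons_rv_row n Y a c).
by apply: mg => i; apply: measurable_split.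
Qed.

Lemma iint0 n : iint (fun _ : 'rV[R]_n => 0) = 0.
Proof.
elim: n => // n IH; rewrite iintS.
by under eq_fun do rewrite IH; rewrite /Rintegral integral0.
Qed.

(** One constant bounds both the values and the coordinates of the support, so that slices inherit
    it unchanged and the slices at |t| > M vanish. *)
Definition bounded_supp n (M : R) (g : 'rV[R]_n -> R) : Prop :=
  forall x, `|g x| <= M /\ (g x != 0 -> forall i, `|x 0 i| <= M).

Lemma bounded_suppW n M M' (g : 'rV[R]_n -> R) :
  M <= M' -> bounded_supp n M g -> bounded_supp n M' g.
Proof.
move=> MM' bg x; have [h1 h2] := bg x; split; first exact: le_trans MM'.
by move=> gx i; apply: le_trans MM'; exact: h2.
Qed.

Lemma bounded_supp_section n M (g : 'rV[R]_n.+1 -> R) t :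
  bounded_supp n.+1 M g -> bounded_supp n M (fun y => g (cons_rv n t y)).
Proof.
move=> bg y; have [h1 h2] := bg (cons_rv n t y); split => // gx i.
by have := h2 gx (lift ord0 i); rewrite cons_rv_lift.
Qed.

Lemma bounded_supp_section0 n M (g : 'rV[R]_n.+1 -> R) t :
  bounded_supp n.+1 M g -> M < `|t| -> (fun y => g (cons_rv n t y)) = fun=> 0.
Proof.
move=> bg Mt; apply/funext => y; apply/eqP/negP => /negP gx.
by have := (bg (cons_rv n t y)).2 gx ord0; rewrite cons_rv0 leNgt Mt.
Qed.

Lemma integrable_bounded_supp (F : R -> R) (M B : R) :
  measurable_fun setT F -> (forall t, `|F t| <= B) ->
  (forall t, M < `|t| -> F t = 0) ->
  lebesgue_measure.-integrable setT (EFin \o F).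
Proof.
move=> mF FB FM.
have -> : EFin \o F = (EFin \o F) \_ `[- M, M]%classic.
  apply/funext => t; rewrite patchE; case: ifPn => // /negP.
  rewrite inE /= in_itv/= -ler_norml => /negP.
  by rewrite -ltNge => /FM ->.
rewrite -integrable_mkcond//; apply: measurable_bounded_integrable => //.
- have := @lebesgue_measure_itv R `[- M, M]; rewrite /= => ->.
  by case: ifP => _; rewrite ?ltry// -EFinB ltry.
- exact: measurable_funS mF.
- exists B; split; first exact: num_real.
  by move=> x Bx t _; apply: le_trans (FB t) (ltW Bx).
Qed.

(** The bound must be uniform in g, since the slices of one function vary with t: it is what
    dominates the inner integral by a multiple of the indicator of [-M, M] and makes it
    integrable. *)
Lemma iint_bound n M : exists2 B, 0 <= B & forall g,
  bmeas n g -> bounded_supp n M g -> `|iint g| <= B.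
Proof.
elim: n => [|n [B B0 IH]].
  exists `|M| => // g _ bg; exact: le_trans (bg 0).1 (ler_norm _).
pose phi (t : R) : R := if `|t| <= M then B else 0.
have mphi : measurable_fun setT phi.
  apply: measurable_fun_ifT => //.
  by apply: measurable_fun_ler => //; exact: normr_measurable.
have phi0 t : 0 <= phi t by rewrite /phi; case: ifP.
have iphi : lebesgue_measure.-integrable setT (EFin \o phi).
  apply: (integrable_bounded_supp _ M B) => // t.
    by rewrite ger0_norm// /phi; case: ifP.
  by rewrite ltNge /phi => /negbTE ->.
exists (\int[lebesgue_measure]_t phi t); first exact: Rintegral_ge0.
move=> g mg bg; rewrite iintS.
set F := fun t => _.
have F0 t : M < `|t| -> F t = 0.
  by move=> Mt; rewrite /F (bounded_supp_section0 _ _ _ _ bg Mt) iint0.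
have Fphi t : `|F t| <= phi t.
  rewrite /phi; case: ifPn => [_|]; last by rewrite -ltNge => /F0 ->; rewrite normr0.
  by apply: IH; [exact: bmeas_section|exact: bounded_supp_section].
have iF : lebesgue_measure.-integrable setT (EFin \o F).
  apply: (integrable_bounded_supp _ M B) => //.
    exact: measurable_iint_section.
  by move=> t; apply: le_trans (Fphi t) _; rewrite /phi; case: ifP.
have := le_normr_Rintegral measurableT iF.
move=> /le_trans; apply.
apply: le_Rintegral => //.
by have := integrable_norm iF; apply: eq_integrable.
Qed.

Lemma integrable_iint_section n (g : 'rV[R]_n.+1 -> R) M :
  bmeas n.+1 g -> bounded_supp n.+1 M g ->
  lebesgue_measure.-integrable setT
    (EFin \o (fun t : R => iint (fun y => g (cons_rv n t y)))).
Proof.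
move=> mg bg; have [B B0 hB] := iint_bound n M.
apply: (integrable_bounded_supp _ M B).
- exact: measurable_iint_section.
- by move=> t; apply: hB; [exact: bmeas_section|exact: bounded_supp_section].
- by move=> t Mt; rewrite (bounded_supp_section0 _ _ _ _ bg Mt) iint0.
Qed.

Lemma iint_linear n (a : R) (g h : 'rV[R]_n -> R) M :
  bmeas n g -> bounded_supp n M g -> bmeas n h -> bounded_supp n M h ->
  iint (fun x => a * g x + h x) = a * iint g + iint h.
Proof.
elim: n g h => [//|n IH] g h mg bg mh bh; rewrite !iintS.
have ig := integrable_iint_section _ _ _ mg bg.
have ih := integrable_iint_section _ _ _ mh bh.
rewrite -RintegralZl//.
rewrite -RintegralD//; last first.
  by have := integrableZl measurableT a ig; apply: eq_integrable.
congr Rintegral; apply/funext => t.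
by rewrite IH//; [exact: bmeas_section|exact: bounded_supp_section|
  exact: bmeas_section|exact: bounded_supp_section].
Qed.

Lemma iint_le n (g h : 'rV[R]_n -> R) M :
  bmeas n g -> bounded_supp n M g -> bmeas n h -> bounded_supp n M h ->
  (forall x, g x <= h x) -> iint g <= iint h.
Proof.
elim: n g h => [|n IH] g h mg bg mh bh gh; first exact: gh.
rewrite !iintS; apply: le_Rintegral => //.
- exact: integrable_iint_section mg bg.
- exact: integrable_iint_section mh bh.
- move=> t _; apply: IH => //; [exact: bmeas_section|exact: bounded_supp_section|
  exact: bmeas_section|exact: bounded_supp_section].
Qed.

(* A class of null sets that the iterated integral ignores slice by slice. *)
Fixpoint thin (n : nat) : set 'rV[R]_n -> Prop :=
  match n return set 'rV[R]_n -> Prop with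
  | 0 => fun A => A = set0
  | n'.+1 => fun A => exists E : seq R, forall t, t \notin E ->
      thin n' [set y | A (cons_rv n' t y)]
  end.

Lemma thinS n (A B : set 'rV[R]_n) : A `<=` B -> thin n B -> thin n A.
Proof.
elim: n A B => [|n IH] A B AB /=; first by move=> B0; rewrite -subset0 -B0.
move=> [E hE]; exists E => t /hE; apply: IH => y; exact: AB.
Qed.

Lemma thin0 n : thin n set0.
Proof. by elim: n => //= n IH; exists [::]. Qed.

Lemma thinU n (A B : set 'rV[R]_n) : thin n A -> thin n B -> thin n (A `|` B).
Proof.
elim: n A B => [|n IH] A B /=; first by move=> -> ->; rewrite setU0.
move=> [E hE] [E' hE']; exists (E ++ E') => t.
rewrite mem_cat negb_or => /andP[/hE h /hE' h']; exact: IH.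
Qed.

Lemma thin_bigcup n (I : eqType) (s : seq I) (A : I -> set 'rV[R]_n) :
  (forall i, i \in s -> thin n (A i)) ->
  thin n [set x | exists2 i, i \in s & A i x].
Proof.
elim: s => [_|i s IH hA]; first by apply: thinS (thin0 n) => x [].
apply: (thinS _ _ (A i `|` [set x | exists2 i, i \in s & A i x])).
  move=> x [j]; rewrite inE => /orP[/eqP -> ?|js ?]; first by left.
  by right; exists j.
apply: thinU; first by apply: hA; rewrite mem_head.
by apply: IH => j js; apply: hA; rewrite inE js orbT.
Qed.

(** If some coefficient beyond the first is nonzero, every slice is again a hyperplane. Otherwise
    the equation involves t alone and at most one value of t gives a nonempty slice. *)
Lemma thin_hyperplane n (a : 'rV[R]_n) (b : R) : a != 0 \/ b != 0 ->
  thin n [set x | \sum_i a 0 i * x 0 i + b = 0].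
Proof.
elim: n a b => [|n IH] a b ab /=.
  apply/seteqP; split => // x /=; rewrite big_ord0 add0r => b0.
  case: ab => [|/eqP//]; have -> : a = 0 by apply/rowP => -[].
  by rewrite eqxx.
have sum_cons t y : \sum_i a 0 i * cons_rv n t y 0 i =
    a 0 ord0 * t + \sum_i rsubmx (a : 'rV_(1 + n)) 0 i * y 0 i.
  rewrite big_ord_recl cons_rv0; congr (_ + _).
  apply: eq_bigr => i _; rewrite cons_rv_lift mxE; congr (a 0 _ * _).
  exact: val_inj.
have [ra0|ra0] := eqVneq (rsubmx (a : 'rV_(1 + n))) 0; last first.
  exists [::] => t _; apply: (thinS _ _ [set y |
      \sum_i rsubmx (a : 'rV_(1 + n)) 0 i * y 0 i + (a 0 ord0 * t + b) = 0]).
    by move=> y /=; rewrite sum_cons => e; rewrite -[RHS]e; ring.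
  by apply: IH; left.
(* When this coefficient is zero, the quotient is the default 0, a harmless exceptional value: then
   b is nonzero and every slice is empty. *)
exists [:: - b / a 0 ord0] => t; rewrite inE => tE.
apply: (thinS _ _ set0); last exact: thin0.
move=> y /=; rewrite sum_cons ra0 big1 ?addr0; last by move=> i _; rewrite mxE mul0r.
have [a0|a0] := eqVneq (a 0 ord0) 0.
  rewrite a0 mul0r add0r => b0; case: ab; rewrite ?b0 ?eqxx//.
  move=> /negP; apply; apply/eqP/rowP => i; rewrite mxE.
  have [j ->|->] := unliftP ord0 i; last exact: a0.
  have := congr1 (fun m : 'rV_n => m 0 j) ra0; rewrite !mxE => <-.
  by congr (a 0 _); apply: val_inj.
move=> e; move: tE => /eqP; apply.
by apply: (mulfI a0); rewrite mulrCA mulfV// mulr1; lra.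
Qed.

Lemma measurable_seq_neq (E : seq R) (F G : R -> R) :
  measurable_fun setT G -> (forall t, t \notin E -> F t = G t) ->
  measurable_fun setT F.
Proof.
elim: E F G => [|e E IH] F G mG FG.
  by rewrite (_ : F = G)//; apply/funext => t; exact: FG.
apply: (IH F (fun t => if t == e then F e else G t)).
  apply: measurable_fun_ifT => //.
  by apply: measurable_fun_eqr => //.
move=> t tE; case: eqVneq => [->//|te]; apply: FG.
by rewrite inE negb_or te.
Qed.

(** Only g is assumed Borel. By induction the slice integrals of f and g agree for all t outside a
    finite set, which transfers measurability to f and gives equality almost everywhere. *)
Lemma iint_thin n (A : set 'rV[R]_n) (f g : 'rV[R]_n -> R) :
  thin n A -> bmeas n g -> (forall x, ~ A x -> f x = g x) -> iint f = iint g.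
Proof.
elim: n A f g => [|n IH] A f g /=.
  by move=> -> _ fg; apply: fg.
move=> [E hE] mg fg.
have mG := measurable_iint_section n g mg.
set F := fun t => iint (fun y => f (cons_rv n t y)).
set G := fun t => iint (fun y => g (cons_rv n t y)) in mG *.
have FG t : t \notin E -> F t = G t.
  move=> /hE tA; apply: IH tA _ _; first exact: bmeas_section.
  by move=> y; exact: fg.
have mF : measurable_fun setT F by exact: measurable_seq_neq mG FG.
rewrite -[LHS]/(Rintegral lebesgue_measure setT F).
rewrite -[RHS]/(Rintegral lebesgue_measure setT G).
rewrite /Rintegral; congr fine; apply: ae_eq_integral => //.
- exact/measurable_EFinP.
- exact/measurable_EFinP.
exists [set` E]; split.
- exact: countable_measurable (finite_set_countable (finite_seq E)).
- exact: countable_lebesgue_measure0 (finite_set_countable (finite_seq E)).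
- move=> t /= h; apply/negPn/negP => tE; apply: h => _; rewrite FG//.
Qed.

End IteratedIntegral.

(** * Admissible integrands *)

Section Admissible.
Context {R : realType}.

(** Agreement off a thin set is built in because the pointwise derivative of a finite element
    function is uncontrolled on the faces of the mesh. *)
Definition adm n (g : 'rV[R]_n -> R) : Prop :=
  exists h A, [/\ bmeas n h, exists M, bounded_supp n M h, thin n A &
    forall x, ~ A x -> g x = h x].

Lemma bounded_supp2 n (g h : 'rV[R]_n -> R) :
  (exists M, bounded_supp n M g) -> (exists M, bounded_supp n M h) ->
  exists M, [/\ 0 <= M, bounded_supp n M g & bounded_supp n M h].
Proof.
move=> [M Mg] [M' Mh]; exists (Num.max M M'); split.
- by rewrite le_max (le_trans (normr_ge0 _) (Mg 0).1).
- by apply: bounded_suppW Mg; rewrite le_max lexx.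
- by apply: bounded_suppW Mh; rewrite le_max lexx orbT.
Qed.

Lemma bounded_supp_linear n (a : R) (g h : 'rV[R]_n -> R) :
  (exists M, bounded_supp n M g) -> (exists M, bounded_supp n M h) ->
  exists M, bounded_supp n M (fun x => a * g x + h x).
Proof.
move=> bg /(bounded_supp2 _ _ _ bg)[M [M0 {}bg bh]].
exists ((`|a| + 1) * M) => x; split.
  rewrite mulrDl mul1r (le_trans (ler_normD _ _))// lerD//; last exact: (bh x).1.
  by rewrite normrM ler_wpM2l//; exact: (bg x).1.
move=> e i; have MM : M <= (`|a| + 1) * M by rewrite ler_peMl// lerDr.
apply: le_trans MM.
have [g0|g0] := eqVneq (g x) 0; last exact: (bg x).2.
have [h0|h0] := eqVneq (h x) 0; last exact: (bh x).2.
by move: e; rewrite g0 h0 mulr0 addr0 eqxx.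
Qed.

Lemma bounded_supp_mul n (g h : 'rV[R]_n -> R) :
  (exists M, bounded_supp n M g) -> (exists M, bounded_supp n M h) ->
  exists M, bounded_supp n M (fun x => g x * h x).
Proof.
move=> bg /(bounded_supp2 _ _ _ bg)[M [M0 {}bg bh]].
exists (M + M * M) => x; split.
  rewrite normrM (@le_trans _ _ (M * M)) ?lerDr//.
  by rewrite ler_pM//; [exact: (bg x).1|exact: (bh x).1].
move=> e i; apply: (@le_trans _ _ M); last by rewrite lerDl mulr_ge0.
by apply: (bg x).2; apply: contraNneq e => ->; rewrite mul0r.
Qed.

Lemma bounded_supp_max n (g h : 'rV[R]_n -> R) :
  (exists M, bounded_supp n M g) -> (exists M, bounded_supp n M h) ->
  exists M, bounded_supp n M (fun x => Num.max (g x) (h x)).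
Proof.
move=> bg /(bounded_supp2 _ _ _ bg)[M [M0 {}bg bh]]; exists M => x.
by rewrite /Num.max; case: ifP.
Qed.

Lemma adm_linear n (a : R) (g h : 'rV[R]_n -> R) :
  adm n g -> adm n h -> adm n (fun x => a * g x + h x).
Proof.
move=> [g' [A [mg bg tA gg']]] [h' [B [mh bh tB hh']]].
exists (fun x => a * g' x + h' x), (A `|` B); split.
- move=> dY Y c mc; apply: measurable_funD; last exact: mh.
  by apply: measurable_funM => //; exact: mg.
- exact: bounded_supp_linear.
- exact: thinU.
- by move=> x /not_orP[nA nB]; rewrite gg'// hh'.
Qed.

Lemma adm_mul n (g h : 'rV[R]_n -> R) :
  adm n g -> adm n h -> adm n (fun x => g x * h x).
Proof.
move=> [g' [A [mg bg tA gg']]] [h' [B [mh bh tB hh']]].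
exists (fun x => g' x * h' x), (A `|` B); split.
- by move=> dY Y c mc; apply: measurable_funM; [exact: mg|exact: mh].
- exact: bounded_supp_mul.
- exact: thinU.
- by move=> x /not_orP[nA nB]; rewrite gg'// hh'.
Qed.

Lemma adm0 n : adm n (fun=> 0).
Proof.
exists (fun=> 0), set0; split=> //; last exact: thin0.
by exists 0 => x; rewrite normr0 eqxx.
Qed.

Lemma adm_thin n (A : set 'rV[R]_n) (g h : 'rV[R]_n -> R) :
  thin n A -> (forall x, ~ A x -> g x = h x) -> adm n h -> adm n g.
Proof.
move=> tA gh [h' [B [mh bh tB hh']]].
exists h', (A `|` B); split => //; first exact: thinU.
by move=> x /not_orP[nA nB]; rewrite gh// hh'.
Qed.

Lemma iint_adm_linear n (a : R) (g h : 'rV[R]_n -> R) :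
  adm n g -> adm n h ->
  iint (fun x => a * g x + h x) = a * iint g + iint h.
Proof.
move=> [g' [A [mg bg tA gg']]] [h' [B [mh bh tB hh']]].
have [M [_ bg' bh']] := bounded_supp2 _ _ _ bg bh.
rewrite (iint_thin _ _ _ _ tA mg gg') (iint_thin _ _ _ _ tB mh hh').
rewrite -(iint_linear _ _ _ _ M)//.
apply: (iint_thin _ (A `|` B)); first exact: thinU.
- move=> dY Y c mc; apply: measurable_funD; last exact: mh.
  by apply: measurable_funM => //; exact: mg.
- by move=> x /not_orP[nA nB]; rewrite gg'// hh'.
Qed.

Lemma iint_adm_le n (A : set 'rV[R]_n) (g h : 'rV[R]_n -> R) :
  adm n g -> adm n h -> thin n A -> (forall x, ~ A x -> g x <= h x) ->
  iint g <= iint h.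
Proof.
move=> [g' [B [mg bg tB gg']]] [h' [C [mh bh tC hh']]] tA gh.
(* Monotonicity of [iint] asks for an inequality at every point, so h' is replaced by max(g', h'),
   which differs from h only on a thin set. *)
have bm := bounded_supp_max _ _ _ bg bh.
have mm : bmeas n (fun x => Num.max (g' x) (h' x)).
  by move=> dY Y c mc; apply: measurable_maxr; [exact: mg|exact: mh].
have [M [_ bg' bm']] := bounded_supp2 _ _ _ bg bm.
rewrite (iint_thin _ _ _ _ tB mg gg').
rewrite (iint_thin _ (A `|` B `|` C) h (fun x => Num.max (g' x) (h' x)))//.
- by apply: (iint_le _ _ _ M) => // x; rewrite le_max lexx.
- by apply: thinU => //; exact: thinU.
- move=> x /not_orP[/not_orP[nA nB] nC].
  by rewrite hh'// -gg'// -hh'//; rewrite max_r//; exact: gh.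
Qed.

(** * Integrals over Omega of functions extended by zero *)

Section Restriction.
Context {d : nat} (Om : set 'rV[R]_d).

Definition restr (g : 'rV[R]_d -> R) x := if x \in Om then g x else 0.
Definition adm_on g := adm d (restr g).

Lemma adm_on_linear a g h :
  adm_on g -> adm_on h -> adm_on (fun x => a * g x + h x).
Proof.
move=> ag ah; apply: (adm_thin _ _ _ _ (thin0 d) _ (adm_linear _ a _ _ ag ah)).
by move=> x _; rewrite /restr; case: ifP => _ //; rewrite mulr0 addr0.
Qed.

Lemma adm_on_mul g h : adm_on g -> adm_on h -> adm_on (fun x => g x * h x).
Proof.
move=> ag ah; apply: (adm_thin _ _ _ _ (thin0 d) _ (adm_mul _ _ _ ag ah)).
by move=> x _; rewrite /restr; case: ifP => _ //; rewrite mulr0.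
Qed.

Lemma adm_on_sum (n : nat) (c : 'I_n -> R) (g : 'I_n -> 'rV[R]_d -> R) :
  (forall j, adm_on (g j)) -> adm_on (fun x => \sum_j c j * g j x).
Proof.
elim: n c g => [|n IH] c g ag.
  apply: (adm_thin _ _ _ _ (thin0 d) _ (adm0 d)).
  by move=> x _; rewrite /restr big_ord0; case: ifP.
rewrite (_ : (fun x => _) = fun x => c ord0 * g ord0 x
    + \sum_j c (lift ord0 j) * g (lift ord0 j) x); last first.
  by apply/funext => x; rewrite big_ord_recl.
exact/adm_on_linear/IH.
Qed.

Lemma adm_on_thin A g h : thin d A -> (forall x, Om x -> ~ A x -> g x = h x) ->
  adm_on h -> adm_on g.
Proof.
move=> tA gh; apply: (adm_thin _ _ _ _ tA) => x nA.
by rewrite /restr; case: ifPn => //; rewrite inE => /gh ->.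
Qed.

Lemma integ_linear a g h : adm_on g -> adm_on h ->
  integ Om (fun x => a * g x + h x) = a * integ Om g + integ Om h.
Proof.
move=> ag ah; rewrite -(iint_adm_linear _ a _ _ ag ah); congr iint.
by apply/funext => x; rewrite /restr; case: ifP => _ //; rewrite mulr0 addr0.
Qed.

Lemma integ_sum (n : nat) (c : 'I_n -> R) (g : 'I_n -> 'rV[R]_d -> R) :
  (forall j, adm_on (g j)) ->
  integ Om (fun x => \sum_j c j * g j x) = \sum_j c j * integ Om (g j).
Proof.
elim: n c g => [|n IH] c g ag.
  rewrite big_ord0 -[RHS](iint0 d); congr iint.
  by apply/funext => x; rewrite big_ord0; case: ifP.
rewrite (_ : (fun x => _) = fun x => c ord0 * g ord0 x
    + \sum_j c (lift ord0 j) * g (lift ord0 j) x); last first.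
  by apply/funext => x; rewrite big_ord_recl.
rewrite integ_linear ?IH ?big_ord_recl//.
exact: adm_on_sum.
Qed.

Lemma integ_le A g h : adm_on g -> adm_on h -> thin d A ->
  (forall x, Om x -> ~ A x -> g x <= h x) -> integ Om g <= integ Om h.
Proof.
move=> ag ah tA gh; apply: (iint_adm_le _ A _ _ ag ah tA) => x nA.
by rewrite /restr; case: ifPn => //; rewrite inE => /gh ->.
Qed.

Lemma integ_thin A g h : adm_on h -> thin d A ->
  (forall x, Om x -> ~ A x -> g x = h x) -> integ Om g = integ Om h.
Proof.
move=> ah tA gh; have ag := adm_on_thin _ _ _ tA gh ah.
by apply/eqP; rewrite eq_le !(integ_le A)// => x Ox nA; rewrite gh.
Qed.

Lemma integ_ge0 g : (forall x, Om x -> 0 <= g x) -> 0 <= integ Om g.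
Proof.
move=> g0; have {g0} : forall x, 0 <= restr g x.
  by move=> x; rewrite /restr; case: ifPn => //; rewrite inE => /g0.
rewrite /integ -/(restr g); elim: d (restr g) => [|n IH] h h0; first exact: h0.
by rewrite iintS; apply: Rintegral_ge0 => t _; exact: IH.
Qed.

End Restriction.

(** * Measurability of open sets and continuous functions, tested by coordinates *)

Lemma ball_rV n (x y : 'rV[R]_n) e : 0 < e ->
  ball x e y <-> forall i, `|x 0 i - y 0 i| < e.
Proof.
move=> e0; split => [[_ xy] i|xy].
  by have := xy 0 i; rewrite -ball_normE.
by split => // i j; rewrite -ball_normE /ball_/= (ord1 i); exact: xy.
Qed.

Lemma measurable_ball_row n dY (Y : measurableType dY) (c : 'I_n -> Y -> R)
    x e : 0 < e ->
  (forall i, measurable_fun setT (c i)) ->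
  measurable [set y | ball x e (\row_i c i y)].
Proof.
move=> e0 mc.
rewrite (_ : [set y | _] =
    \bigcap_(i in [set: 'I_n]) [set y | `|x 0 i - c i y| < e]).
  apply: fin_bigcap_measurable => // i _.
  have mf : measurable_fun setT (fun y => `|x 0 i - c i y| < e).
    apply: measurable_fun_ltr => //.
    by apply: measurableT_comp => //; apply: measurable_funB.
  by have := mf measurableT [set true] I; rewrite setTI.
apply/seteqP; split => y /=.
  by move=> /(ball_rV _ _ _ _ e0) h i _; have := h i; rewrite mxE.
by move=> h; apply/ball_rV => // i; rewrite mxE; exact: h.
Qed.

(** An open set is a countable union of balls with rational centres and radii 1/(k+1), and a ball of
    the sup norm is a finite intersection of conditions on single coordinates. *)
Lemma measurable_open_row n dY (Y : measurableType dY) (c : 'I_n -> Y -> R)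
    (A : set 'rV[R]_n) : open A ->
  (forall i, measurable_fun setT (c i)) -> measurable [set y | A (\row_i c i y)].
Proof.
move=> oA mc.
pose cen (p : 'rV[rat]_n * nat) : 'rV[R]_n := \row_i ratr (p.1 0 i).
pose rad (p : 'rV[rat]_n * nat) : R := p.2.+1%:R^-1.
have rad0 p : 0 < rad p by rewrite invr_gt0.
pose D := [set p | ball (cen p) (rad p) `<=` A].
rewrite (_ : [set y | _] =
    \bigcup_(p in D) [set y | ball (cen p) (rad p) (\row_i c i y)]).
  rewrite bigcup_mkcond; apply: countable_bigcupT_measurable => [|p].
    exact: countableP.
  case: ifP => // _; apply: measurable_ball_row => //; exact: rad0.
apply/seteqP; split => y /=; last by move=> [p Dp] /Dp.
set x := \row_i c i y => Ax.
have : nbhs x A by exact: open_nbhs_nbhs.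
move=> /nbhs_ballP[e /= e0 eA].
have [k ke] : exists k, k.+1%:R^-1 < e / 2 :> R.
  have [k _ /(_ k (leqnn k))] :=
    near_infty_natSinv_lt (PosNum (divr_gt0 e0 (ltr0Sn R 1))).
  by exists k.
have k0 : 0 < k.+1%:R^-1 :> R by rewrite invr_gt0.
have hq i : exists q : rat, `|ratr q - x 0 i| < k.+1%:R^-1.
  have lk : x 0 i - k.+1%:R^-1 < x 0 i + k.+1%:R^-1.
    by rewrite (lt_trans (y := x 0 i))// ?ltrDl// ltrBlDr ltrDl.
  have [q] := rat_in_itvoo lk.
  by rewrite in_itv/= => hq; exists q; rewrite ltr_distl.
have [q qx] := choice hq.
exists (\row_i q i, k).
  move=> z /(ball_rV _ _ _ _ (rad0 _)) hz; apply: eA; apply/ball_rV => // i.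
  have := hz i; have := qx i; rewrite !mxE /rad/= => h1 h2.
  rewrite (_ : _ - z 0 i = - (ratr (q i) - c i y) + (ratr (q i) - z 0 i));
    last by ring.
  apply: le_lt_trans (ler_normD _ _) _; rewrite normrN.
  by move: h1 h2 ke; move: (k.+1%:R^-1 : R) => r; lra.
apply/(ball_rV _ _ _ _ (rad0 _)) => i.
by have := qx i; rewrite /rad/cen/= !mxE.
Qed.

Lemma adm_on_continuous n (W : set 'rV[R]_n) (u : 'rV[R]_n -> R) (M : R) :
  open W -> (forall x, W x -> forall i, `|x 0 i| <= M) ->
  {in W, continuous u} -> (forall x, W x -> `|u x| <= M) -> adm_on W u.
Proof.
move=> oW WM uc uM; exists (restr W u), set0; split => //; last first.
  exact: thin0.
  exists (Num.max 0 M) => x; rewrite /restr; case: ifPn => [|_].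
    rewrite inE => Wx; split; first by rewrite le_max uM ?orbT.
    by move=> _ i; rewrite le_max WM ?orbT.
  by rewrite normr0 eqxx le_max lexx.
have oWu a : open (W `&` [set x | a < u x]).
  rewrite openE => x [Wx ux]; apply: filterI; first exact: open_nbhs_nbhs.
  have := uc x (mem_set Wx).
  move=> /(_ [set y | a < y]); apply; apply: open_nbhs_nbhs.
  by split => //; exact: open_gt.
move=> dY Y c mc mT; apply: (measurability _ (RGenOInfty.measurableE R)) => //.
move=> _ [_ [a ->] <-]; rewrite setTI.
have m1 := measurable_open_row _ _ _ _ _ (oWu a) mc.
have m2 := measurable_open_row _ _ _ _ _ oW mc.
(* The extension is 0 outside W, so for a < 0 the superlevel set also contains the complement of
   W. *)
have [a0|a0] := ltP a 0; last first.
  rewrite (_ : _ @^-1` _ = [set y | (W `&` [set x | a < u x]) (\row_i c i y)])//.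
  apply/seteqP; split => y /=; rewrite /restr in_itv/= andbT.
    by case: ifPn => [|_]; [rewrite inE|rewrite ltNge a0].
  by move=> [Wy ay]; rewrite mem_set.
rewrite (_ : _ @^-1` _ = [set y | (W `&` [set x | a < u x]) (\row_i c i y)]
    `|` ~` [set y | W (\row_i c i y)]).
  by apply: measurableU => //; exact: measurableC.
apply/seteqP; split => y /=; rewrite /restr in_itv/= andbT.
  by case: ifPn => [|/negP nW]; rewrite ?inE; [left|right => /mem_set].
by move=> [[Wy ay]|nW]; [rewrite mem_set|rewrite memNset].
Qed.

End Admissible.

(** * Barycentric coordinates *)

Section Affine.
Context {R : realType} {d : nat}.

Definition aff (b : R) (a : 'rV[R]_d) (x : 'rV[R]_d) : R :=
  b + \sum_i a 0 i * x 0 i.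

Lemma aff_continuous b a : continuous (aff b a).
Proof.
have lin : continuous (fun x : 'rV[R]_d => \sum_i a 0 i * x 0 i).
  apply: (@continuous_big R 'I_d +%R 0 predT) => [|i _ x].
    exact: add_continuous.
  apply: (@continuousM R _ (cst (a 0 i)) (fun y : 'rV[R]_d => y 0 i)).
    exact: cst_continuous.
  exact: coord_continuous.
move=> x; apply: (@continuousD R _ _ (cst b)); last exact: lin.
exact: cst_continuous.
Qed.

Lemma aff_linear c b a b' a' x :
  aff (c * b + b') (c *: a + a') x = c * aff b a x + aff b' a' x.
Proof.
rewrite /aff (eq_bigr (fun i => c * (a 0 i * x 0 i) + a' 0 i * x 0 i)).
  by rewrite big_split -mulr_sumr /=; ring.
by move=> i _; rewrite !mxE; ring.
Qed.

Lemma pderiv_aff i b a x : pderiv i (aff b a) x = a 0 i.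
Proof.
rewrite /pderiv /derive.
apply: cvg_lim => //; apply: (@cvg_near_cst _ _ (a 0 i)).
near=> h.
have h0 : h != 0 by near: h; exact: nbhs_dnbhs_neq.
rewrite /= /aff opprD addrACA subrr add0r -sumrB (bigD1 i)//= big1.
  by rewrite addr0 !mxE !eqxx /= mulr1 /GRing.scale /=; field.
move=> k ki; rewrite !mxE (negbTE ki) andbF mulr0 add0r; ring.
Unshelve. all: by end_near.
Qed.

Lemma pderiv_near i (u : 'rV[R]_d -> R) b a x :
  (\forall y \near x, u y = aff b a y) -> pderiv i u x = a 0 i.
Proof. by move=> h; rewrite /pderiv (near_eq_derive _ h); exact: pderiv_aff. Qed.

End Affine.

Section Barycentric.
Context {R : realType} {d : nat} (S : simplex (R := R) d).

Let E : 'M[R]_d := \matrix_(i < d, j < d) (S (lift ord0 i) - S ord0) 0 j.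

(** The rows of [E] are the edges issuing from vertex 0, so l solves l E = x - S_0 and carries the
    coordinates of the other vertices; vertex 0 receives the complement to 1. *)
Definition bary (k : 'I_d.+1) (x : 'rV[R]_d) : R :=
  let l := (x - S ord0) *m invmx E in
  match unlift ord0 k with Some j => l 0 j | None => 1 - \sum_j l 0 j end.

Definition inner : set 'rV[R]_d := [set x | forall k, 0 < bary k x].

Lemma bary_sum x : \sum_k bary k x = 1.
Proof.
rewrite big_ord_recl /bary unlift_none.
under [X in _ + X]eq_bigr do rewrite liftK.
by rewrite subrK.
Qed.

Lemma mulmxE_rows (l : 'rV[R]_d) :
  l *m E = \sum_j l 0 j *: (S (lift ord0 j) - S ord0).
Proof.
apply/rowP => i; rewrite mxE summxE; apply: eq_bigr => j _.
by rewrite !mxE.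
Qed.

Lemma sum_scaler_sub (l : 'I_d -> R) (P : 'I_d -> 'rV[R]_d) Q :
  \sum_j l j *: (P j - Q) = \sum_j l j *: P j - (\sum_j l j) *: Q.
Proof. by rewrite scaler_suml -sumrB; apply: eq_bigr => j _; rewrite scalerBr. Qed.

Hypothesis S0 : nondeg S.

Let Eu : E \in unitmx.
Proof. by rewrite unitmxE unitfE. Qed.

Lemma bary_comb x : x = \sum_k bary k x *: S k.
Proof.
rewrite big_ord_recl /bary unlift_none.
under [X in _ + X]eq_bigr do rewrite liftK.
set l := (x - S ord0) *m invmx E.
have : l *m E = x - S ord0 by rewrite mulmxKV.
rewrite mulmxE_rows sum_scaler_sub.
set P := \sum_j _ *: S _ => e.
by rewrite scalerBl scale1r -addrA [X in _ + X]addrC e addrC subrK.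
Qed.

Lemma bary_uniq (l : 'I_d.+1 -> R) x : \sum_k l k = 1 ->
  x = \sum_k l k *: S k -> forall k, bary k x = l k.
Proof.
move=> l1 xl.
have e : (x - S ord0) *m invmx E = \row_j l (lift ord0 j).
  rewrite -[RHS](mulmxK Eu) mulmxE_rows; congr (_ *m _).
  rewrite xl big_ord_recl.
  have -> : l ord0 = 1 - \sum_j l (lift ord0 j) by rewrite -l1 big_ord_recl addrK.
  under [RHS]eq_bigr do rewrite mxE.
  rewrite sum_scaler_sub scalerBl scale1r addrAC [X in X + _]addrAC subrr.
  by rewrite add0r addrC.
move=> k; rewrite /bary; case: unliftP => [j ->|->]; rewrite e ?mxE//.
rewrite -l1 big_ord_recl; under [X in _ - X]eq_bigr do rewrite mxE.
by rewrite addrK.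
Qed.

Lemma hull_bary_ge0 x : hull S x -> forall k, 0 <= bary k x.
Proof. by move=> [l [l0 _ l1 xl]] k; rewrite (bary_uniq l x). Qed.

Lemma inner_hull : inner `<=` hull S.
Proof.
move=> x xS; exists (bary^~ x); split => //.
- by move=> i; exact: ltW.
- exact: bary_sum.
- exact: bary_comb.
Qed.

Lemma bary_vertex k : bary k (S k) = 1.
Proof.
rewrite (bary_uniq (fun j => (j == k)%:R)) ?eqxx//.
  rewrite (bigD1 k)//= eqxx big1 ?addr0// => i ik.
  by rewrite (negbTE ik).
rewrite (bigD1 k)//= eqxx scale1r big1 ?addr0// => i ik.
by rewrite (negbTE ik) scale0r.
Qed.

(** The coordinate takes the value 1 at its own vertex, hence its affine form is not identically
    zero. This makes its zero set thin. *)
Lemma bary_aff k : exists b a, (a != 0 \/ b != 0) /\ bary k = aff b a.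
Proof.
suff [b [a ba]] : exists b a, bary k = aff b a.
  exists b, a; split => //.
  have [a0|] := eqVneq a 0; last by left.
  right; apply/eqP => b0; have := bary_vertex k.
  rewrite ba a0 b0 /aff big1 ?add0r; last by move=> i _; rewrite mxE mul0r.
  by move/eqP; rewrite eq_sym oner_eq0.
have lin j : exists b a, (fun x => ((x - S ord0) *m invmx E) 0 j) = aff b a.
  exists (- \sum_i S ord0 0 i * invmx E i j), (\row_i invmx E i j).
  apply/funext => x; rewrite mxE /aff [RHS]addrC -sumrB; apply: eq_bigr => i _.
  by rewrite !mxE; ring.
rewrite /bary; case: unliftP => [j _|_]; first exact: lin.
have [b hb] := choice lin; have [a ha] := choice hb.
exists (1 - \sum_j b j), (- \sum_j a j); apply/funext => x.
rewrite (eq_bigr (fun j => b j + \sum_i a j 0 i * x 0 i)); last first.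
  by move=> j _; rewrite -[LHS]/((fun x => _) x) (ha j).
rewrite big_split /= /aff opprD addrA; congr (_ + _).
rewrite exchange_big -sumrN; apply: eq_bigr => i _.
by rewrite mxE summxE mulNr mulr_suml.
Qed.

Lemma open_inner : open inner.
Proof.
rewrite openE => x xS; rewrite /interior.
apply: (@filter_forall _ _ (fun k => [set y | 0 < bary k y]) (nbhs x)) => k.
have [b [a [_ ba]]] := bary_aff k.
have /= := xS k; rewrite ba => x0.
have := aff_continuous b a x; move=> /(_ [set y | 0 < y]); apply.
by apply: open_nbhs_nbhs; split => //; exact: open_gt.
Qed.

Lemma thin_bary0 : thin d [set x | exists k, bary k x = 0].
Proof.
apply: (thinS _ _ [set x | exists2 k, k \in enum 'I_d.+1 & bary k x = 0]).
  by move=> x [k xk]; exists k => //; rewrite mem_enum.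
apply: thin_bigcup => k _; have [b [a [ab ->]]] := bary_aff k.
apply: thinS (thin_hyperplane _ _ _ ab) => x /=.
by rewrite /aff addrC.
Qed.

Lemma pderiv_inner (u : 'rV[R]_d -> R) b a x i :
  (forall y, hull S y -> u y = aff b a y) -> inner x -> pderiv i u x = a 0 i.
Proof.
move=> ua xS; apply: (pderiv_near _ _ b).
have : nbhs x inner by apply: open_nbhs_nbhs; split => //; exact: open_inner.
by apply: filterS => y /inner_hull; exact: ua.
Qed.

End Barycentric.

(** * Finite element functions *)

Section FiniteElements.
Context {R : realType} {d : nat} (Om : set 'rV[R]_d) (Th : mesh (R := R) d).

Lemma Xh0 : Xh Om Th (fun=> 0).
Proof.
split => [|S _|//]; first exact: cst_continuous.
by exists 0, 0 => x _; rewrite add0r big1// => i _; rewrite mxE mul0r.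
Qed.

Lemma Xh_linear a u v :
  Xh Om Th u -> Xh Om Th v -> Xh Om Th (fun x => a * u x + v x).
Proof.
move=> [cu pu u0] [cv pv v0]; split.
- move=> x; apply: (@continuousD R _ (subspace (closure Om)) (fun x => a * u x) v).
    apply: (@continuousM R (subspace (closure Om)) (cst a) u); last exact: cu.
    exact: cst_continuous.
  exact: cv.
- move=> S ST; have [b [g ub]] := pu S ST; have [b' [g' vb]] := pv S ST.
  exists (a * b + b'), (a *: g + g') => x xS; rewrite ub// vb//.
  by rewrite -[RHS]/(aff _ _ x) aff_linear.
- by move=> x xO; rewrite u0// v0// mulr0 addr0.
Qed.

Lemma Xh_sum (n : nat) (c : 'I_n -> R) (u : 'I_n -> 'rV[R]_d -> R) :
  (forall j, Xh Om Th (u j)) -> Xh Om Th (fun x => \sum_j c j * u j x).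
Proof.
elim: n c u => [|n IH] c u hu.
  rewrite (_ : (fun x => _) = fun=> 0); first exact: Xh0.
  by apply/funext => x; rewrite big_ord0.
rewrite (_ : (fun x => _) = fun x => c ord0 * u ord0 x
    + \sum_j c (lift ord0 j) * u (lift ord0 j) x).
  exact/Xh_linear/IH.
by apply/funext => x; rewrite big_ord_recl.
Qed.

Lemma seq_uniform_bound (I : eqType) (T : Type) (s : seq I) (P : I -> set T)
    (f : T -> R) :
  (forall i, i \in s -> exists M, forall x, P i x -> f x <= M) ->
  exists M, forall i, i \in s -> forall x, P i x -> f x <= M.
Proof.
elim: s => [_|i s IH hs]; first by exists 0.
have [M hM] := hs i (mem_head i s).
have [|M' hM'] := IH; first by move=> j js; apply: hs; rewrite inE js orbT.
exists (Num.max M M') => j.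
rewrite inE => /orP[/eqP -> x /hM xM|js x /(hM' j js) xM].
  by rewrite le_max xM.
by rewrite le_max xM orbT.
Qed.

Hypotheses (oOm : open Om) (bOm : bounded_set Om) (pTh : Defs.partition Om Th).

Lemma bounded_coords : exists B, forall x, Om x -> forall i, `|x 0 i| <= B.
Proof.
have [M [_ hM]] := bOm; exists (M + 1) => x Ox i.
have := hM (M + 1) ltac:(rewrite ltrDl; exact: ltr01) x Ox; apply: le_trans.
have := @le_bigmax _ R _ 0 (fun ij : 'I_1 * 'I_d => `|x ij.1 ij.2|) (0, i).
by rewrite -mx_normrE.
Qed.

Lemma mesh_hull x : Om x -> exists2 S, S \in Th & hull S x.
Proof.
case: pTh => _ _ e _ /(@subset_closure _ Om).
by rewrite e.
Qed.

Lemma Xh_continuous_in w : Xh Om Th w -> {in Om, continuous w}.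
Proof.
move=> [cw _ _]; rewrite -(continuous_open_subspace _ oOm).
exact: continuous_subspaceW (@subset_closure _ Om) cw.
Qed.

Lemma Xh_bounded w : Xh Om Th w -> exists M, forall x, Om x -> `|w x| <= M.
Proof.
move=> Xw; have [B hB] := bounded_coords.
have [|M hM] := seq_uniform_bound _ _ Th (fun S => [set x | Om x /\ hull S x])
    (fun x => `|w x|).
  move=> S ST; have [_ /(_ S ST)[b [g wb]] _] := Xw.
  exists (`|b| + \sum_i `|g 0 i| * B) => x [Ox Sx]; rewrite wb//.
  apply: le_trans (ler_normD _ _) _; rewrite lerD2l.
  apply: le_trans (ler_norm_sum _ _ _) _; apply: ler_sum => i _.
  by rewrite normrM ler_wpM2l// hB.
by exists M => x Ox; have [S ST Sx] := mesh_hull x Ox; exact: (hM S ST).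
Qed.

Lemma bounded_continuous_adm w : {in Om, continuous w} ->
  (exists M, forall x, Om x -> `|w x| <= M) -> adm_on Om w.
Proof.
move=> cw [M hM]; have [B hB] := bounded_coords.
apply: (adm_on_continuous _ _ _ (Num.max B M)) => //.
  by move=> x Ox i; rewrite le_max hB.
by move=> x Ox; rewrite le_max hM ?orbT.
Qed.

Lemma Xh_adm w : Xh Om Th w -> adm_on Om w.
Proof.
move=> Xw; apply: bounded_continuous_adm; first exact: Xh_continuous_in.
exact: Xh_bounded.
Qed.

Lemma adm_on_cst (c : R) : adm_on Om (fun=> c).
Proof.
apply: bounded_continuous_adm; last by exists `|c|.
by move=> x _; exact: cst_continuous.
Qed.

Lemma lipschitz_comp_adm (f : R -> R -> R) (L K : R) u v :
  (forall x1 y1 x2 y2,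
     `|f x1 y1 - f x2 y2| <= L * `|x1 - x2| + K * `|y1 - y2|) ->
  Xh Om Th u -> Xh Om Th v -> adm_on Om (fun x => f (u x) (v x)).
Proof.
move=> hf Xu Xv; apply: bounded_continuous_adm.
  move=> x Ox; have cu := Xh_continuous_in _ Xu x Ox.
  have cv := Xh_continuous_in _ Xv x Ox.
  suff : f (u y) (v y) @[y --> x] --> f (u x) (v x) by [].
  apply/(@cvgrPdist_lt _ _ _ (nbhs x) (nbhs_filter x)) => e e0.
  (* The constants L and K come without a sign, hence the absolute values; the added 1 keeps the
     divisor positive. *)
  pose r := e / (`|L| + `|K| + 1).
  have LK : 0 < `|L| + `|K| + 1 by have := normr_ge0 L; have := normr_ge0 K; lra.
  have r0 : 0 < r by rewrite divr_gt0.
  have := @cvgr_dist_lt _ _ _ (nbhs x) (nbhs_filter x) _ _ cv _ r0.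
  have := @cvgr_dist_lt _ _ _ (nbhs x) (nbhs_filter x) _ _ cu _ r0.
  apply: filterS2 => y uy vy; apply: le_lt_trans (hf _ _ _ _) _.
  have -> : e = (`|L| + `|K| + 1) * r by rewrite /r mulrC divfK// gt_eqF.
  have bnd (C z : R) : `|z| < r -> C * `|z| <= `|C| * r.
    move=> zr; apply: le_trans (ler_norm _) _; rewrite normrM normr_id.
    by rewrite ler_wpM2l// ltW.
  have := bnd L _ uy; have := bnd K _ vy; lra.
have [B hB] := Xh_bounded _ Xu; have [B' hB'] := Xh_bounded _ Xv.
exists (`|f 0 0| + (`|L| * B + `|K| * B')) => x Ox.
rewrite -[f (u x) _](subrK (f 0 0)) addrC.
apply: le_trans (ler_normD _ _) _; rewrite lerD2l.
apply: le_trans (hf _ _ _ _) _; rewrite !subr0; apply: lerD.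
  apply: le_trans (ler_norm _) _; rewrite normrM normr_id.
  by rewrite ler_wpM2l// hB.
apply: le_trans (ler_norm _) _; rewrite normrM normr_id.
by rewrite ler_wpM2l// hB'.
Qed.

Definition gradient_region : set 'rV[R]_d :=
  Om `&` [set x | exists2 S, S \in Th & inner S x].

Let nondegTh S : S \in Th -> nondeg S.
Proof. by case: pTh => _ h _ _; exact: h. Qed.

(** A point of Omega lies in some closed simplex, where its barycentric coordinates are nonnegative.
    If it is not in the open simplex, one of them is zero. *)
Lemma thin_gradient_region : thin d (Om `\` gradient_region).
Proof.
apply: (thinS _ _ [set x | exists2 S, S \in Th & exists k, bary S k x = 0]).
  move=> x [Ox nW]; have [S ST Sx] := mesh_hull x Ox; exists S => //.
  apply: contrapT => h; apply: nW; split => //; exists S => // k.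
  rewrite lt_neqAle (hull_bary_ge0 _ (nondegTh S ST))// andbT eq_sym.
  by apply/eqP => k0; apply: h; exists k.
by apply: thin_bigcup => S ST; exact: thin_bary0 (nondegTh S ST).
Qed.

Lemma open_gradient_region : open gradient_region.
Proof.
apply: openI => //; rewrite openE => x [S ST Sx]; rewrite /interior.
have : nbhs x (inner S).
  by apply: open_nbhs_nbhs; split => //; exact: open_inner (nondegTh S ST).
by apply: filterS => y yS; exists S.
Qed.

Lemma Xh_pderiv_inner w S i : Xh Om Th w -> S \in Th ->
  exists g, forall x, inner S x -> pderiv i w x = g.
Proof.
move=> [_ /(_ S)hw _] ST; have [b [g wb]] := hw ST.
by exists (g 0 i) => x Sx; exact: (pderiv_inner _ (nondegTh S ST) w b g x i wb Sx).
Qed.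

(** The derivative jumps across faces, but on the open [gradient_region] it is locally constant and
    takes finitely many values, at most one per simplex; the rest of Omega is thin. *)
Lemma pderiv_adm w i : Xh Om Th w -> adm_on Om (pderiv i w).
Proof.
move=> Xw; have [B hB] := bounded_coords.
have [|M hM] := seq_uniform_bound _ _ Th inner (fun x => `|pderiv i w x|).
  move=> S ST; have [g hg] := Xh_pderiv_inner w S i Xw ST.
  by exists `|g| => x /hg ->.
have aW : adm_on gradient_region (pderiv i w).
  apply: (adm_on_continuous _ _ _ (Num.max B M)).
  - exact: open_gradient_region.
  - by move=> x [Ox _] k; rewrite le_max hB.
  - move=> x; rewrite inE => -[_ [S ST Sx]].
    have [g hg] := Xh_pderiv_inner w S i Xw ST.
    apply: (@near_cst_continuous _ _ g).
    have : nbhs x (inner S).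
      by apply: open_nbhs_nbhs; split => //; exact: open_inner (nondegTh S ST).
    by apply: filterS => y /hg.
  - by move=> x [_ [S ST Sx]]; rewrite le_max (hM S ST) ?orbT.
apply: (adm_thin _ _ _ _ thin_gradient_region _ aW) => x nA.
rewrite /restr; case: ifPn => [|/negP nO].
  rewrite inE => Ox; case: ifPn => // /negP nW; exfalso; apply: nA.
  by split => // /mem_set.
by case: ifPn => //; rewrite inE => -[/mem_set].
Qed.

Lemma pderiv_linear i a u v x : Xh Om Th u -> Xh Om Th v ->
  gradient_region x ->
  pderiv i (fun x => a * u x + v x) x = a * pderiv i u x + pderiv i v x.
Proof.
move=> [_ pu _] [_ pv _] [_ [S ST Sx]].
have [b [g ub]] := pu S ST; have [b' [g' vb]] := pv S ST.
have S0 := nondegTh S ST.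
rewrite (pderiv_inner _ S0 u b g)// (pderiv_inner _ S0 v b' g')//.
rewrite (pderiv_inner _ S0 _ (a * b + b') (a *: g + g'))//; first by rewrite !mxE.
by move=> y yS; rewrite aff_linear ub// vb.
Qed.

Lemma pderiv_cst0 i (x : 'rV[R]_d) : pderiv i (fun=> 0 : R) x = 0.
Proof. by rewrite /pderiv derive_cst. Qed.

Lemma pderiv_sum i (n : nat) (c : 'I_n -> R) (u : 'I_n -> 'rV[R]_d -> R) x :
  (forall j, Xh Om Th (u j)) -> gradient_region x ->
  pderiv i (fun x => \sum_j c j * u j x) x = \sum_j c j * pderiv i (u j) x.
Proof.
move=> + Wx; elim: n c u => [|n IH] c u hu.
  rewrite big_ord0 (_ : (fun x => _) = fun=> 0); first exact: pderiv_cst0.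
  by apply/funext => y; rewrite big_ord0.
rewrite (_ : (fun x => _) = fun x => c ord0 * u ord0 x
    + \sum_j c (lift ord0 j) * u (lift ord0 j) x).
  rewrite pderiv_linear// ?IH ?big_ord_recl//.
  exact: Xh_sum.
by apply/funext => y; rewrite big_ord_recl.
Qed.

End FiniteElements.

(** * Energy inequalities *)

Section Energy.
Context {R : realType} {d : nat} (Om : set 'rV[R]_d).

Lemma integ0 : integ Om (fun=> 0 : R) = 0.
Proof.
rewrite /integ -[RHS](iint0 d); congr iint.
by apply/funext => x; case: ifP.
Qed.

Lemma adm_on0 : adm_on Om (fun=> 0 : R).
Proof.
apply: (adm_thin _ _ _ _ (thin0 d) _ (adm0 d)) => x _.
by rewrite /restr; case: ifP.
Qed.

Lemma adm_onZ a g : adm_on Om g -> adm_on Om (fun x => a * g x).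
Proof.
move=> ag; have := adm_on_linear _ a _ _ ag adm_on0.
by congr adm_on; apply/funext => x; rewrite addr0.
Qed.

Lemma adm_onD g h : adm_on Om g -> adm_on Om h -> adm_on Om (fun x => g x + h x).
Proof.
move=> ag ah; have := adm_on_linear _ 1 _ _ ag ah.
by congr adm_on; apply/funext => x; rewrite mul1r.
Qed.

Lemma integZ a g : adm_on Om g -> integ Om (fun x => a * g x) = a * integ Om g.
Proof.
move=> ag; rewrite -[RHS]addr0 -integ0 -(integ_linear _ _ _ _ ag adm_on0).
by congr integ; apply/funext => x; rewrite addr0.
Qed.

Lemma integD g h : adm_on Om g -> adm_on Om h ->
  integ Om (fun x => g x + h x) = integ Om g + integ Om h.
Proof.
move=> ag ah; rewrite -[integ Om g]mul1r -(integ_linear _ _ _ _ ag ah).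
by congr integ; apply/funext => x; rewrite mul1r.
Qed.

Lemma integ_le_pointwise g h : adm_on Om g -> adm_on Om h ->
  (forall x, g x <= h x) -> integ Om g <= integ Om h.
Proof. by move=> ag ah gh; apply: (integ_le _ _ _ _ ag ah (thin0 d)). Qed.

Lemma L2ip_ge0 u : 0 <= L2ip Om u u.
Proof. by apply: integ_ge0 => x _; rewrite -expr2 sqr_ge0. Qed.

Lemma H1ip_ge0 u : 0 <= H1ip Om u u.
Proof.
by apply: integ_ge0 => x _; apply: sumr_ge0 => i _; rewrite -expr2 sqr_ge0.
Qed.

Context (alpha tau : R) (alpha0 : 0 < alpha) (alpha1 : alpha < 1).

Lemma DfracE (phi : nat -> 'rV[R]_d -> R) n : Dfrac alpha tau phi n =
  fun x => \sum_(j < n.+1) (tau `^ (- alpha) * bcoef alpha (n - j)) * phi j x.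
Proof.
apply/funext => x; rewrite /Dfrac mulr_sumr.
by apply: eq_bigr => j _; rewrite mulrA.
Qed.

Lemma Dfrac_adm phi n : (forall j, (j <= n)%N -> adm_on Om (phi j)) ->
  adm_on Om (Dfrac alpha tau phi n).
Proof.
by move=> ap; rewrite DfracE; apply: adm_on_sum => j; apply: ap; rewrite -ltnS.
Qed.

Lemma shiftal_adm phi n : (forall j, (j <= n.+1)%N -> adm_on Om (phi j)) ->
  adm_on Om (shiftal alpha phi n.+1).
Proof. by move=> ap; apply: adm_on_linear; [|apply: adm_onZ]; exact: ap. Qed.

Lemma Dfrac_L2_ge phi n : (forall j, (j <= n.+1)%N -> adm_on Om (phi j)) ->
  tau `^ (- alpha)
    * (\sum_(j < n.+2) bcoef alpha (n.+1 - j) * L2ip Om (phi j) (phi j)) / 2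
  <= L2ip Om (Dfrac alpha tau phi n.+1) (shiftal alpha phi n.+1).
Proof.
move=> ap; have ap' (j : 'I_n.+2) : adm_on Om (fun x => phi j x * phi j x).
  by apply: adm_on_mul; apply: ap; rewrite -ltnS.
rewrite [leLHS](_ : _ = integ Om (fun x => \sum_(j < n.+2)
    (tau `^ (- alpha) / 2 * bcoef alpha (n.+1 - j)) * (phi j x * phi j x))).
  apply: integ_le_pointwise.
  - exact: adm_on_sum.
  - by apply: adm_on_mul; [exact: Dfrac_adm|exact: shiftal_adm].
  move=> x; have := bcoef_conv_ge alpha alpha0 alpha1 (phi^~ x) n.
  move=> /(ler_wpM2l (powR_ge0 tau (- alpha))); rewrite /Dfrac /shiftal /= => h.
  rewrite [leRHS]mulrC mulrCA; apply: le_trans h.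
  rewrite mulrA mulr_sumr mulr_suml le_eqVlt; apply/orP; left; apply/eqP.
  by apply: eq_bigr => j _; ring.
rewrite integ_sum// mulr_sumr mulr_suml; apply: eq_bigr => j _.
by rewrite -/(L2ip Om (phi j) (phi j)); ring.
Qed.

Context (Th : mesh (R := R) d).
Hypotheses (oOm : open Om) (bOm : bounded_set Om) (pTh : Defs.partition Om Th).

Lemma Dfrac_Xh phi n : (forall j, (j <= n)%N -> Xh Om Th (phi j)) ->
  Xh Om Th (Dfrac alpha tau phi n).
Proof.
by move=> Xp; rewrite DfracE; apply: Xh_sum => j; apply: Xp; rewrite -ltnS.
Qed.

Lemma XhZ a u : Xh Om Th u -> Xh Om Th (fun x => a * u x).
Proof.
move=> Xu; have := Xh_linear _ _ a _ _ Xu (Xh0 Om Th).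
by congr (Xh Om Th); apply/funext => x; rewrite addr0.
Qed.

Lemma shiftal_Xh phi n : (forall j, (j <= n.+1)%N -> Xh Om Th (phi j)) ->
  Xh Om Th (shiftal alpha phi n.+1).
Proof. by move=> Xp; apply: Xh_linear; [|apply: XhZ]; exact: Xp. Qed.

(** On [gradient_region], space derivatives commute with the finite sums in time, so this is
    [Dfrac_L2_ge] for each partial derivative, summed over the directions. *)
Lemma Dfrac_H1_ge phi n : (forall j, (j <= n.+1)%N -> Xh Om Th (phi j)) ->
  tau `^ (- alpha)
    * (\sum_(j < n.+2) bcoef alpha (n.+1 - j) * H1ip Om (phi j) (phi j)) / 2
  <= H1ip Om (shiftal alpha phi n.+1) (Dfrac alpha tau phi n.+1).
Proof.
move=> Xp; pose P i j := pderiv i (phi j).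
have aP i j : (j <= n.+1)%N -> adm_on Om (P i j).
  by move=> jn; apply: pderiv_adm (Xp j jn).
have aDS i : adm_on Om (fun x => Dfrac alpha tau (P i) n.+1 x
    * shiftal alpha (P i) n.+1 x).
  by apply: adm_on_mul; [apply: Dfrac_adm|apply: shiftal_adm]; exact: aP.
have -> : H1ip Om (shiftal alpha phi n.+1) (Dfrac alpha tau phi n.+1)
    = \sum_i 1 * L2ip Om (Dfrac alpha tau (P i) n.+1) (shiftal alpha (P i) n.+1).
  rewrite -integ_sum// /H1ip.
  apply: (integ_thin _ _ _ _ _ (thin_gradient_region Om Th pTh)).
    exact: adm_on_sum.
  move=> x Ox nW; have Wx : gradient_region Om Th x.
    by apply: contrapT => h; apply: nW.
  apply: eq_bigr => i _; rewrite mul1r mulrC; congr (_ * _).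
    rewrite !DfracE (pderiv_sum _ _ pTh)// => j.
    by apply: Xp; rewrite -ltnS.
  have Xn : Xh Om Th (phi n) by apply: Xp.
  have e : pderiv i (fun x => alpha / 2 * phi n x) x = alpha / 2 * P i n x.
    have := pderiv_linear _ _ pTh i (alpha / 2) _ _ x Xn (Xh0 Om Th) Wx.
    rewrite pderiv_cst0 addr0 => <-; congr (pderiv i _ x).
    by apply/funext => y; rewrite addr0.
  rewrite /shiftal /= (pderiv_linear _ _ pTh i _ _ _ x _ (XhZ _ _ Xn) Wx) ?e//.
  exact: Xp.
have HE j : (j <= n.+1)%N ->
    H1ip Om (phi j) (phi j) = \sum_i 1 * L2ip Om (P i j) (P i j).
  move=> jn; rewrite -integ_sum; last by move=> i; apply: adm_on_mul; exact: aP.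
  by congr integ; apply/funext => x; apply: eq_bigr => i _; rewrite mul1r.
have -> : tau `^ (- alpha)
    * (\sum_(j < n.+2) bcoef alpha (n.+1 - j) * H1ip Om (phi j) (phi j)) / 2
  = \sum_i tau `^ (- alpha)
    * (\sum_(j < n.+2) bcoef alpha (n.+1 - j) * L2ip Om (P i j) (P i j)) / 2.
  rewrite -mulr_suml -mulr_sumr exchange_big; congr (_ * _ / _).
  apply: eq_bigr => j _; rewrite HE -1?ltnS// mulr_sumr.
  by apply: eq_bigr => i _; rewrite mul1r.
apply: ler_sum => i _; rewrite mul1r; apply: Dfrac_L2_ge => j; exact: aP.
Qed.

(** The shifted value is a convex combination of two consecutive ones, and its square is at most the
    sum of their squares. This is why the energies at both levels n+1 and n enter the recursion. *)
Lemma integ_quadratic_le (c : R) (G : 'rV[R]_d -> R) (U V : nat -> 'rV[R]_d -> R) n :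
  0 <= c -> adm_on Om G ->
  (forall j, (j <= n.+1)%N -> adm_on Om (U j)) ->
  (forall j, (j <= n.+1)%N -> adm_on Om (V j)) ->
  (forall x, G x <= c * (1 + shiftal alpha U n.+1 x ^+ 2
                           + shiftal alpha V n.+1 x ^+ 2)) ->
  integ Om G <= c * (integ Om (fun=> 1)
    + (L2ip Om (U n.+1) (U n.+1) + L2ip Om (V n.+1) (V n.+1)
    + (L2ip Om (U n) (U n) + L2ip Om (V n) (V n)))).
Proof.
move=> c0 aG aU aV hG; have a0 := alpha0; have a1 := alpha1.
have a_1 : adm_on Om (fun=> 1 : R) by exact: adm_on_cst.
have sq (W : nat -> 'rV[R]_d -> R) j :
    (forall j, (j <= n.+1)%N -> adm_on Om (W j)) ->
    (j <= n.+1)%N -> adm_on Om (fun x => W j x * W j x).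
  by move=> aW jn; apply: adm_on_mul; exact: aW.
have aU1 := sq U n.+1 aU (leqnn _); have aU0 := sq U n aU (leqnSn _).
have aV1 := sq V n.+1 aV (leqnn _); have aV0 := sq V n aV (leqnSn _).
have aUV1 := adm_onD _ _ aU1 aV1; have aUV0 := adm_onD _ _ aU0 aV0.
have aUV := adm_onD _ _ aUV1 aUV0; have aQ := adm_onD _ _ a_1 aUV.
rewrite /L2ip -(integD _ _ aU1 aV1) -(integD _ _ aU0 aV0).
rewrite -(integD _ _ aUV1 aUV0) -(integD _ _ a_1 aUV) -(integZ _ _ aQ).
apply: integ_le_pointwise => //; first exact: adm_onZ.
move=> x; apply: le_trans (hG x) _; rewrite ler_wpM2l//.
have convex (p q : R) : ((1 - alpha / 2) * p + alpha / 2 * q) ^+ 2 <= p * p + q * q.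
  rewrite -subr_ge0.
  have -> : p * p + q * q - ((1 - alpha / 2) * p + alpha / 2 * q) ^+ 2
      = (1 - alpha / 2) * (alpha / 2) * (p - q) ^+ 2
        + alpha / 2 * p ^+ 2 + (1 - alpha / 2) * q ^+ 2 by field.
  have h1 : 0 <= 1 - alpha / 2 by lra.
  have h2 : 0 <= alpha / 2 by lra.
  by apply: addr_ge0; first apply: addr_ge0;
    rewrite mulr_ge0// ?sqr_ge0// mulr_ge0.
have := convex (U n.+1 x) (U n x); have := convex (V n.+1 x) (V n x).
by rewrite /shiftal /=; lra.
Qed.

End Energy.

(** Linear growth |f| <= k (1 + |x| + |y|), where k >= 1 also bounds |x| and |y| by the same
    quantity; the factor 3 comes from squaring a sum of three terms. The products with x and y serve
    the L^2 estimates of the two equations, the square of f the gradient estimates. *)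
Lemma lipschitz_growth {R : realType} (f : R -> R -> R) (L K : R) :
  (forall x1 y1 x2 y2,
     `|f x1 y1 - f x2 y2| <= L * `|x1 - x2| + K * `|y1 - y2|) ->
  exists2 c, 0 < c & forall x y,
    [/\ f x y * x <= c * (1 + x ^+ 2 + y ^+ 2),
        f x y * y <= c * (1 + x ^+ 2 + y ^+ 2) &
        f x y * f x y <= c * (1 + x ^+ 2 + y ^+ 2)].
Proof.
move=> hf; pose k := `|f 0 0| + `|L| + `|K| + 1.
have k1 : 1 <= k.
  have := normr_ge0 (f 0 0); have := normr_ge0 L; have := normr_ge0 K.
  by rewrite /k; lra.
exists (3 * k ^+ 2); first by rewrite mulr_gt0// exprn_gt0//; lra.
move=> x y; pose s := 1 + `|x| + `|y|.
have x0 := normr_ge0 x; have y0 := normr_ge0 y.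
have s1 : 1 <= s by rewrite /s; lra.
have fk : `|f x y| <= k * s.
  have : `|f x y| <= `|f 0 0| + (`|L| * `|x| + `|K| * `|y|).
    rewrite -[f x y](subrK (f 0 0)) addrC.
    apply: le_trans (ler_normD _ _) _; rewrite lerD2l.
    apply: le_trans (hf _ _ _ _) _; rewrite !subr0.
    by apply: lerD; rewrite ler_wpM2r// ler_norm.
  move=> /le_trans; apply; rewrite -subr_ge0.
  have -> : k * s - (`|f 0 0| + (`|L| * `|x| + `|K| * `|y|))
    = `|f 0 0| * (`|x| + `|y|) + `|L| * (1 + `|y|) + `|K| * (1 + `|x|)
      + (1 + `|x| + `|y|) by rewrite /k /s; ring.
  by rewrite !addr_ge0// mulr_ge0// addr_ge0.
have ss : s ^+ 2 <= 3 * (1 + x ^+ 2 + y ^+ 2).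
  have nsq (z : R) : z ^+ 2 = `|z| ^+ 2 by rewrite -normrX ger0_norm// sqr_ge0.
  rewrite (nsq x) (nsq y) /s -subr_ge0.
  have -> : 3 * (1 + `|x| ^+ 2 + `|y| ^+ 2) - (1 + `|x| + `|y|) ^+ 2
    = (1 - `|x|) ^+ 2 + (1 - `|y|) ^+ 2 + (`|x| - `|y|) ^+ 2 by ring.
  by rewrite !addr_ge0// sqr_ge0.
have kss : k ^+ 2 * s ^+ 2 <= 3 * k ^+ 2 * (1 + x ^+ 2 + y ^+ 2).
  by have := ler_wpM2l (sqr_ge0 k) ss; lra.
have bnd z : `|z| <= k * s -> f x y * z <= 3 * k ^+ 2 * (1 + x ^+ 2 + y ^+ 2).
  move=> zk; apply: le_trans kss; apply: le_trans (ler_norm _) _.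
  by rewrite normrM -exprMn expr2 ler_pM.
have sk : s <= k * s by rewrite ler_peMl//; lra.
split; apply: bnd => //; apply: le_trans sk; rewrite /s; lra.
Qed.

(** * One time step of one equation: [W] stands for [U] or [V], [Mc] for the value of the nonlocal
    coefficient *)

Section Steps.
Context {R : realType} {d : nat} (Om : set 'rV[R]_d) (Th : mesh (R := R) d).
Hypotheses (oOm : open Om) (bOm : bounded_set Om) (pTh : Defs.partition Om Th).
Context (alpha tau : R).
Hypotheses (alpha0 : 0 < alpha) (alpha1 : alpha < 1).
Context (f : R -> R -> R) (L K c m Mc : R).
Hypotheses (hf : forall x1 y1 x2 y2,
  `|f x1 y1 - f x2 y2| <= L * `|x1 - x2| + K * `|y1 - y2|).
Hypotheses (c0 : 0 < c) (m0 : 0 < m) (mM : m <= Mc).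
Context (U V W : nat -> 'rV[R]_d -> R) (n : nat).
Hypotheses (XU : forall j, (j <= n.+1)%N -> Xh Om Th (U j))
  (XV : forall j, (j <= n.+1)%N -> Xh Om Th (V j))
  (XW : forall j, (j <= n.+1)%N -> Xh Om Th (W j)).

Let su := shiftal alpha U n.+1.
Let sv := shiftal alpha V n.+1.
Let sw := shiftal alpha W n.+1.
Let F := fun x => f (su x) (sv x).

Hypothesis eqW : forall w, Xh Om Th w ->
  L2ip Om (Dfrac alpha tau W n.+1) w + Mc * H1ip Om sw w = L2ip Om F w.

Definition total_L2 j := L2ip Om (U j) (U j) + L2ip Om (V j) (V j).

Let vol := integ Om (fun=> 1 : R).

Let aF : adm_on Om F.
Proof.
exact: (lipschitz_comp_adm Om Th oOm bOm pTh f L K su sv hf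
  (shiftal_Xh Om alpha Th U n XU) (shiftal_Xh Om alpha Th V n XV)).
Qed.

Let aX (P : nat -> 'rV[R]_d -> R) :
  (forall j, (j <= n.+1)%N -> Xh Om Th (P j)) ->
  forall j, (j <= n.+1)%N -> adm_on Om (P j).
Proof. by move=> XP j /XP; exact: (Xh_adm Om Th oOm bOm pTh). Qed.

(** With [sw] as test function the diffusion term is nonnegative and is dropped. The right-hand side
    involves both components because f couples them. *)
Lemma step_L2 :
  (forall x, F x * sw x <= c * (1 + su x ^+ 2 + sv x ^+ 2)) ->
  tau `^ (- alpha)
    * (\sum_(j < n.+2) bcoef alpha (n.+1 - j) * L2ip Om (W j) (W j))
  <= 2 * c * (vol + (total_L2 n.+1 + total_L2 n)).
Proof.
move=> hF; have Xs := shiftal_Xh Om alpha Th W n XW.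
have h1 := eqW _ Xs; rewrite -/sw in h1.
have h2 := Dfrac_L2_ge Om alpha tau alpha0 alpha1 W n (aX W XW).
rewrite -/sw in h2.
have h3 : 0 <= Mc * H1ip Om sw sw.
  by rewrite mulr_ge0 ?H1ip_ge0// (le_trans (ltW m0)).
have aG : adm_on Om (fun x => F x * sw x).
  exact: (adm_on_mul _ _ _ aF (Xh_adm Om Th oOm bOm pTh _ Xs)).
have := integ_quadratic_le Om alpha alpha0 alpha1 oOm bOm c _ U V n (ltW c0) aG
  (aX U XU) (aX V XV) hF.
rewrite -/(L2ip Om F sw) -h1 -/vol -/(total_L2 n.+1) -/(total_L2 n).
lra.
Qed.

(** With the discrete derivative D of [W] as test function, (D, D) + Mc (grad sw, grad D) = (F, D).
    The square (D, D) cancels against Young's inequality, so the bound contains only L^2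
    energies. *)
Lemma step_H1 :
  (forall x, F x * F x <= c * (1 + su x ^+ 2 + sv x ^+ 2)) ->
  tau `^ (- alpha)
    * (\sum_(j < n.+2) bcoef alpha (n.+1 - j) * H1ip Om (W j) (W j))
  <= 2 * (c * (vol + (total_L2 n.+1 + total_L2 n)) / m).
Proof.
move=> hF; have XD := Dfrac_Xh Om alpha tau Th W n.+1 XW.
have h1 := eqW _ XD.
have h2 := Dfrac_H1_ge Om alpha tau alpha0 alpha1 Th oOm bOm pTh W n XW.
rewrite -/sw in h2.
set D := Dfrac alpha tau W n.+1 in h1 h2 XD.
have aD : adm_on Om D := Xh_adm Om Th oOm bOm pTh _ XD.
have aFF : adm_on Om (fun x => F x * F x) by exact: adm_on_mul.
have aDD : adm_on Om (fun x => D x * D x) by exact: adm_on_mul.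
have aFD : adm_on Om (fun x => F x * D x) by exact: adm_on_mul.
have h3 : L2ip Om F D <= L2ip Om D D + 4^-1 * L2ip Om F F.
  rewrite /L2ip -integZ// -integD//; last exact: adm_onZ.
  apply: integ_le_pointwise => //; first by apply: adm_onD => //; exact: adm_onZ.
  move=> x; rewrite -subr_ge0.
  have -> : D x * D x + 4^-1 * (F x * F x) - F x * D x = (D x - F x / 2) ^+ 2.
    by field.
  exact: sqr_ge0.
have h4 := integ_quadratic_le Om alpha alpha0 alpha1 oOm bOm c _ U V n (ltW c0) aFF
  (aX U XU) (aX V XV) hF.
rewrite -/(L2ip Om F F) -/vol -/(total_L2 n.+1) -/(total_L2 n) in h4.
set Q := c * (vol + _) in h4 *.
have F0 := L2ip_ge0 Om F.
have h5 : Mc * H1ip Om sw D <= Q by lra.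
(* The product H1ip of [sw] and D may be negative, so replacing Mc by its lower bound m needs a case
   distinction on its sign. *)
have h6 : H1ip Om sw D <= Q / m.
  have Q0 : 0 <= Q by lra.
  have [H0|H0] := lerP (H1ip Om sw D) 0.
    by apply: le_trans H0 _; rewrite divr_ge0// ltW.
  rewrite ler_pdivlMr// mulrC; apply: le_trans h5.
  by rewrite ler_wpM2r// ltW.
move: (Q / m) h6 => G h6.
lra.
Qed.

End Steps.

Theorem theorem1 (R : realType) (d : nat) (Om : set 'rV[R]_d) (alpha T : R)
  (M1 M2 f1 f2 : R -> R -> R)
  (m1 m2 L1' K1' L2' K2' L1 K1 L2 K2 : R) (F : set (@mesh R d)) :
  (1 <= d <= 3)%N ->
  open Om -> connected Om -> Om !=set0 -> bounded_set Om ->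
  0 < alpha < 1 -> 0 < T ->
  (* (H1) *)
  0 < m1 -> m1 <= m2 ->
  (forall x y, m1 <= M1 x y <= m2) -> (forall x y, m1 <= M2 x y <= m2) ->
  (* (H2) *)
  (forall x1 y1 x2 y2,
     `|M1 x1 y1 - M1 x2 y2| <= L1' * `|x1 - x2| + K1' * `|y1 - y2|) ->
  (forall x1 y1 x2 y2,
     `|M2 x1 y1 - M2 x2 y2| <= L2' * `|x1 - x2| + K2' * `|y1 - y2|) ->
  (* (H3) *)
  (forall x1 y1 x2 y2,
     `|f1 x1 y1 - f1 x2 y2| <= L1 * `|x1 - x2| + K1 * `|y1 - y2|) ->
  (forall x1 y1 x2 y2,
     `|f2 x1 y1 - f2 x2 y2| <= L2 * `|x1 - x2| + K2 * `|y1 - y2|) ->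
  (* the meshes Omega_h range over a quasi-uniform family of partitions *)
  quasi_uniform_family Om F ->
  exists2 taustar : R, 0 < taustar &
  exists2 C : R, 0 < C &
  forall Th, F Th ->
  forall N : nat, (0 < N)%N -> T / N%:R <= taustar ->
  forall U V : nat -> 'rV[R]_d -> R,
    (forall n, (n <= N)%N -> Xh Om Th (U n) /\ Xh Om Th (V n)) ->
    U 0%N = (fun _ => 0) -> V 0%N = (fun _ => 0) ->
    (forall n, (1 <= n <= N)%N -> forall w, Xh Om Th w ->
       L2ip Om (Dfrac alpha (T / N%:R) U n) w
       + M1 (lfun Om (shiftal alpha U n)) (lfun Om (shiftal alpha V n))
         * H1ip Om (shiftal alpha U n) w
       = L2ip Om (fun x => f1 (shiftal alpha U n x) (shiftal alpha V n x)) w) ->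
    (forall n, (1 <= n <= N)%N -> forall w, Xh Om Th w ->
       L2ip Om (Dfrac alpha (T / N%:R) V n) w
       + M2 (lfun Om (shiftal alpha U n)) (lfun Om (shiftal alpha V n))
         * H1ip Om (shiftal alpha V n) w
       = L2ip Om (fun x => f2 (shiftal alpha U n x) (shiftal alpha V n x)) w) ->
    forall n, (1 <= n <= N)%N ->
      L2norm Om (U n) + L2norm Om (V n) <= C /\
      H1semi Om (U n) + H1semi Om (V n) <= C.
Proof.
move=> _ oOm _ _ bOm /andP[a0 a1] T0 m10 _ hM1 hM2 _ _ hf1 hf2 [qF _].
have [c1 c10 hc1] := lipschitz_growth f1 L1 K1 hf1.
have [c2 c20 hc2] := lipschitz_growth f2 L2 K2 hf2.
have [vol vol0 volE] : exists2 v, 0 <= v & integ Om (fun=> 1 : R) = v.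
  by exists (integ Om (fun=> 1 : R)) => //; apply: integ_ge0 => x _; exact: ler01.
have [c [c0 c1c c2c]] : exists c, [/\ 0 < c, c1 <= c & c2 <= c].
  by exists (c1 + c2); rewrite addr_gt0 ?lerDl ?lerDr ?ltW.
have grow (c' x y : R) : c' <= c ->
    c' * (1 + x ^+ 2 + y ^+ 2) <= c * (1 + x ^+ 2 + y ^+ 2).
  by move=> ?; rewrite ler_wpM2r// !addr_ge0// sqr_ge0.
(* Each of the two equations contributes 2 c (vol + Y_{n+1} + Y_n), whence the factor 4. *)
have [||taus1 taus10 [E E0 gronE]] :=
  frac_gronwall_uniform alpha a0 a1 (4 * c * vol) (4 * c) T _ _ T0.
- by rewrite mulr_ge0// mulr_ge0// ltW.
- by rewrite mulr_ge0// ltW.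
have [G G0 GE] : exists2 G, 0 <= G & c * (vol + (E + E)) / m1 = G.
  exists (c * (vol + (E + E)) / m1) => //.
  by rewrite divr_ge0 ?mulr_ge0 ?addr_ge0// ltW.
(* Here [G] is the bound of [step_H1] with both L^2 energies replaced by E; as G is a constant, the
   second application has C1 = 0. *)
have [||taus2 taus20 [E' E'0 gronE']] :=
  frac_gronwall_uniform alpha a0 a1 (4 * G) 0 T _ _ T0 => //.
  by rewrite mulr_ge0.
exists (Num.min taus1 taus2); first by rewrite lt_min taus10.
(* The energies are sums of two squared norms, so each norm is at most the square root of the energy
   bound; the factor 2 counts U and V. *)
exists (2 * (Num.sqrt E + Num.sqrt E')).
  by rewrite mulr_gt0// addr_gt0// sqrtr_gt0.
move=> Th FTh N N0; rewrite le_min => /andP[tau1 tau2] U V XUV U0 V0 eqU eqV.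
have pTh := qF Th FTh.
set tau := T / N%:R in eqU eqV.
have XU j : (j <= N)%N -> Xh Om Th (U j) by move=> /XUV[].
have XV j : (j <= N)%N -> Xh Om Th (V j) by move=> /XUV[].
pose Y := total_L2 Om U V.
pose Z j := H1ip Om (U j) (U j) + H1ip Om (V j) (V j).
have L20 : L2ip Om (fun=> 0 : R) (fun=> 0) = 0.
  rewrite /L2ip (_ : (fun x => _) = fun=> 0) ?integ0//.
  by apply/funext => x; rewrite mulr0.
have H10 : H1ip Om (fun=> 0 : R) (fun=> 0) = 0.
  rewrite /H1ip (_ : (fun x => _) = fun=> 0) ?integ0//; apply/funext => x.
  by rewrite big1// => i _; rewrite pderiv_cst0 mulr0.
have sumD (h f g : nat -> R) k : (forall j, h j = f j + g j) ->
    tau `^ (- alpha) * (\sum_(j < k.+2) bcoef alpha (k.+1 - j) * h j)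
    = tau `^ (- alpha) * (\sum_(j < k.+2) bcoef alpha (k.+1 - j) * f j)
      + tau `^ (- alpha) * (\sum_(j < k.+2) bcoef alpha (k.+1 - j) * g j).
  move=> hfg; rewrite -mulrDr -big_split /=; congr (_ * _).
  by apply: eq_bigr => j _; rewrite hfg mulrDr.
have XUk k j : (k < N)%N -> (j <= k.+1)%N -> Xh Om Th (U j).
  by move=> kN jk; apply: XU; exact: leq_trans jk kN.
have XVk k j : (k < N)%N -> (j <= k.+1)%N -> Xh Om Th (V j).
  by move=> kN jk; apply: XV; exact: leq_trans jk kN.
have coef1 k : m1 <= M1 (lfun Om (shiftal alpha U k)) (lfun Om (shiftal alpha V k)).
  by have /andP[] := hM1 (lfun Om (shiftal alpha U k)) (lfun Om (shiftal alpha V k)).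
have coef2 k : m1 <= M2 (lfun Om (shiftal alpha U k)) (lfun Om (shiftal alpha V k)).
  by have /andP[] := hM2 (lfun Om (shiftal alpha U k)) (lfun Om (shiftal alpha V k)).
have YE : forall j, (j <= N)%N -> Y j <= E.
  apply: (gronE N Y N0 tau1); first by rewrite /Y /total_L2 U0 V0 L20 addr0 ler01.
  move=> k kN; rewrite (sumD Y (fun j => L2ip Om (U j) (U j))
    (fun j => L2ip Om (V j) (V j)) k (fun=> erefl)).
  rewrite (_ : _ + 4 * c * _ = 2 * c * (vol + (Y k.+1 + Y k))
    + 2 * c * (vol + (Y k.+1 + Y k))); last by ring.
  apply: lerD; rewrite -volE.
  - apply: (step_L2 Om Th oOm bOm pTh alpha tau a0 a1 f1 L1 K1 c m1 _ hf1 c0 m10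
      (coef1 k.+1) U V U k (fun j => XUk k j kN)
      (fun j => XVk k j kN) (fun j => XUk k j kN) (eqU k.+1 kN)).
    by move=> x; apply: le_trans (grow _ _ _ c1c);
      case: (hc1 (shiftal alpha U k.+1 x) (shiftal alpha V k.+1 x)).
  - apply: (step_L2 Om Th oOm bOm pTh alpha tau a0 a1 f2 L2 K2 c m1 _ hf2 c0 m10
      (coef2 k.+1) U V V k (fun j => XUk k j kN)
      (fun j => XVk k j kN) (fun j => XVk k j kN) (eqV k.+1 kN)).
    by move=> x; apply: le_trans (grow _ _ _ c2c);
      case: (hc2 (shiftal alpha U k.+1 x) (shiftal alpha V k.+1 x)).
have ZE : forall j, (j <= N)%N -> Z j <= E'.
  apply: (gronE' N Z N0 tau2); first by rewrite /Z U0 V0 H10 addr0 ler01.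
  move=> k kN; rewrite (sumD Z (fun j => H1ip Om (U j) (U j))
    (fun j => H1ip Om (V j) (V j)) k (fun=> erefl)) mul0r addr0.
  have YG : 2 * (c * (vol + (Y k.+1 + Y k)) / m1) <= 2 * G.
    rewrite ler_pM2l// -GE ler_pM2r ?invr_gt0// ler_pM2l// lerD2l.
    by apply: lerD; apply: YE => //; exact: ltnW.
  rewrite (_ : 4 * G = 2 * G + 2 * G); last by ring.
  apply: lerD; apply: le_trans YG; rewrite -volE.
  - apply: (step_H1 Om Th oOm bOm pTh alpha tau a0 a1 f1 L1 K1 c m1 _ hf1 c0 m10
      (coef1 k.+1) U V U k (fun j => XUk k j kN)
      (fun j => XVk k j kN) (fun j => XUk k j kN) (eqU k.+1 kN)).
    by move=> x; apply: le_trans (grow _ _ _ c1c);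
      case: (hc1 (shiftal alpha U k.+1 x) (shiftal alpha V k.+1 x)).
  - apply: (step_H1 Om Th oOm bOm pTh alpha tau a0 a1 f2 L2 K2 c m1 _ hf2 c0 m10
      (coef2 k.+1) U V V k (fun j => XUk k j kN)
      (fun j => XVk k j kN) (fun j => XVk k j kN) (eqV k.+1 kN)).
    by move=> x; apply: le_trans (grow _ _ _ c2c);
      case: (hc2 (shiftal alpha U k.+1 x) (shiftal alpha V k.+1 x)).
have E1 := sqrtr_ge0 E; have E2 := sqrtr_ge0 E'.
have two_sqrt (a b e e' : R) : 0 <= a -> 0 <= b -> a + b <= e -> 0 <= e' ->
    Num.sqrt a + Num.sqrt b <= 2 * (Num.sqrt e + e').
  move=> ha hb ab he'.
  have e0 : 0 <= e by apply: le_trans ab; exact: addr_ge0.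
  have sa : Num.sqrt a <= Num.sqrt e by rewrite ler_sqrt//; lra.
  have sb : Num.sqrt b <= Num.sqrt e by rewrite ler_sqrt//; lra.
  lra.
move=> n /andP[_ nN]; split.
  by apply: two_sqrt; rewrite ?L2ip_ge0//; exact: YE.
rewrite [Num.sqrt E + _]addrC.
by apply: two_sqrt; rewrite ?H1ip_ge0//; exact: ZE.
Qed.
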